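(* Let $G=SU(2)$ with the K-P Cartan decomposition $su(2)=\mathcal{K}\oplus\mathcal{P}$, where $\mathcal{K}$ is the set of diagonal matrices and $\mathcal{P}$ the set of antidiagonal matrices in $su(2)$, and let $K=e^{\mathcal{K}}$ be the group of diagonal matrices in $SU(2)$. Equip $SU(2)$ with the sub-Riemannian structure whose horizontal distribution at $X$ is $\{BX: B\in\mathcal{P}\}$, with metric induced by a bi-invariant inner product on $su(2)$. Then the set of diagonal matrices $K=SU(2)_{\text{sing}}$ coincides with the sub-Riemannian cut locus of the identity $\mathbf{1}$.
   Context: The inner product on $su(2)$ is $\langle A|B\rangle=-\tfrac12\mathrm{Tr}(AB)$ (a positive multiple of the negative Killing form), and $SU(2)$ carries the corresponding bi-invariant Riemannian metric $\langle AX,BX\rangle_X=\langle A|B\rangle$. A curve $\gamma$ in $SU(2)$ is horizontal if $\dot\gamma(t)\gamma(t)^{-1}\in\mathcal{P}$ for all $t$. The sub-Riemannian distance between two points is the infimum of the lengths of horizontal curves joining them; a distance-minimizing horizontal curve is a sub-Riemannian geodesic. Optimal trajectories starting at $\mathbf 1$ have the form $\gamma(t)=e^{At}e^{(-A+P)t}$ with $A\in\mathcal{K}$, $P\in\mathcal{P}$. The cut locus of $\mathbf 1$ is the set of points where geodesics starting from $\mathbf 1$ lose optimality. The group $K$ acts on $SU(2)$ by conjugation, $X\mapsto kXk^{-1}$. The minimal isotropy group of this action is $\{\pm\mathbf 1\}$, which is the isotropy group of every non-diagonal matrix, while diagonal matrices have isotropy group $K$. $SU(2)_{\text{sing}}$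 is the set of points whose isotropy group is not the minimal one; it is exactly the set $K$ of diagonal matrices.
   Formalization: No nontrivial minimizing geodesic from 1 ends at 1, so the literal cut locus is K without 1; the base point 1 is counted in its own cut locus here when geodesics from 1 lose optimality arbitrarily close to it. Horizontal curves are taken to be C^1. *)

(* Defs.v *)
From HB Require Import structures.
From mathcomp Require Import all_boot all_order all_algebra spectral.
From mathcomp Require Import complex.
From mathcomp Require Import ring lra.
From mathcomp Require Import all_classical all_reals all_analysis.

Set Implicit Arguments.
Unset Strict Implicit.
Unset Printing Implicit Defensive.

Import Order.TTheory GRing.Theory Num.Theory.
Import numFieldNormedType.Exports.
Local Open Scope classical_set_scope.
Local Open Scope complex_scope.
Local Open Scope sesquilinear_scope.
Local Open Scope ring_scope.

Section SU2.
Variable R : realType.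
Local Notation mx := ('M[R[i]]_2).

Definition SU2 : set mx := [set X | X \is unitarymx /\ \det X = 1].

Definition su2 : set mx := [set A | A ^t* = - A /\ \tr A = 0].

Definition antidiagonal (A : mx) : Prop :=
  forall i j : 'I_2, j != rev_ord i -> A i j = 0.

Definition su2_diag : set mx := su2 `&` [set A | is_diag_mx A].
Definition su2_antidiag : set mx := su2 `&` [set A | antidiagonal A].

Lemma su2_cartan (A : mx) : su2 A <->
  exists! KP : mx * mx, [/\ su2_diag KP.1, su2_antidiag KP.2 & A = KP.1 + KP.2].
Proof.
split=> [[Ah trA]|[[K P] [[[[Kh trK] _] [[Ph trP] _] ->] _]]]; last first.
  by split; rewrite /= ?mxtraceD ?trK ?trP ?addr0// linearD/= map_mxD Kh Ph opprD.
have rev (i : 'I_2) : rev_ord i != i by case: i => -[|[|]].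
have nrev (i j : 'I_2) : j != rev_ord i -> j = i.
  by case: i j => -[|[|//]] ? [[|[|//]] ?] // _; apply/val_inj.
have Aij i j : (A j i)^* = - A i j by have /matrixP/(_ i j) := Ah; rewrite !mxE.
exists (\matrix_(i, j) (A i j *+ (i == j)), \matrix_(i, j) (A i j *+ (i != j))).
split=> [|[K P] [[_ /is_diag_mxP Kd] [_ Pa] AE]].
  split; [split|split|]; [split| |split| |].
  - apply/matrixP=> i j; rewrite !mxE eq_sym.
    by case: eqP => _; rewrite ?mulr1n ?mulr0n ?rmorph0 ?oppr0.
  - by rewrite -[RHS]trA; apply: eq_bigr => i _; rewrite mxE eqxx.
  - by apply/is_diag_mxP => i j ij; rewrite mxE -val_eqE (negbTE ij).
  - apply/matrixP=> i j; rewrite !mxE eq_sym.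
    by case: eqP => _; rewrite ?mulr1n ?mulr0n ?rmorph0 ?oppr0.
  - by apply: big1 => i _; rewrite mxE eqxx.
  - by move=> i j /nrev ->; rewrite mxE eqxx.
  - by apply/matrixP=> i j; rewrite !mxE; case: eqP; rewrite ?addr0 ?add0r.
have P0 i : P i i = 0 by apply: Pa; rewrite eq_sym rev.
have K0 i j : i != j -> K i j = 0 by move=> ij; apply: Kd; rewrite val_eqE.
congr (_, _); apply/matrixP=> i j; rewrite AE !mxE; case: eqVneq => [->|ij] /=.
- by rewrite P0 addr0.
- by rewrite K0.
- by rewrite P0.
- by rewrite K0// add0r.
Qed.

Definition SU2_diag : set mx := SU2 `&` [set X | is_diag_mx X].

Definition isotropy (X : mx) : set mx :=
  [set k | SU2_diag k /\ k *m X *m invmx k = X].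

(* The acting group is abelian, so conjugate isotropy groups are equal and
   the minimal isotropy group is one contained in all the others. *)
Definition minimal_isotropy (H : set mx) : Prop :=
  (exists2 X, SU2 X & H = isotropy X) /\
  (forall X, SU2 X -> H `<=` isotropy X).

Definition SU2_sing : set mx :=
  [set X | SU2 X /\ ~ minimal_isotropy (isotropy X)].

(* An inner product on the real vector space su(2), invariant under the
   adjoint action; the values of [ip] outside su(2) are irrelevant. *)
Record biinvariant_inner_product (ip : mx -> mx -> R) : Prop := {
  ip_linear : forall (a : R) (A B D : mx), su2 A -> su2 B -> su2 D ->
    ip (a%:C *: A + B) D = a * ip A D + ip B D;
  ip_sym : forall A B : mx, su2 A -> su2 B -> ip A B = ip B A;
  ip_pos : forall A : mx, su2 A -> A != 0 -> 0 < ip A A;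
  ip_ad : forall X A B : mx, SU2 X -> su2 A -> su2 B ->
    ip (X *m A *m invmx X) (X *m B *m invmx X) = ip A B }.

(* <A|B> = - Tr (A B) / 2, which is real on su(2) *)
Definition trace_ip (A B : mx) : R := - (complex.Re (\tr (A *m B)) / 2).

(* [g] is C^1 on [0, T] with derivative [v], one-sided at the endpoints. *)
Definition C1_real (T : R) (g v : R -> R) : Prop :=
  [/\ {within `[0, T], continuous g},
      {within `[0, T], continuous v} &
      forall t, t \in `]0, T[ -> is_derive t (1 : R) g (v t)].

Definition C1_curve (T : R) (g v : R -> mx) : Prop :=
  forall i j : 'I_2,
    C1_real T (fun t => complex.Re (g t i j)) (fun t => complex.Re (v t i j)) /\
    C1_real T (fun t => complex.Im (g t i j)) (fun t => complex.Im (v t i j)).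

Definition right_velocity (g v : R -> mx) (t : R) : mx := v t *m invmx (g t).

Record horizontal_curve (T : R) (g v : R -> mx) : Prop := {
  hc_time : 0 <= T;
  hc_C1 : C1_curve T g v;
  hc_SU2 : forall t, t \in `[0, T] -> SU2 (g t);
  hc_horizontal : forall t, t \in `[0, T] ->
    su2_antidiag (right_velocity g v t) }.

Section Metric.
Variable ip : mx -> mx -> R.

(* The metric is right-invariant, so |BX|_X = |B|. *)
Definition speed (g v : R -> mx) (t : R) : R :=
  Num.sqrt (ip (right_velocity g v t) (right_velocity g v t)).

Definition curve_length (T : R) (g v : R -> mx) : R :=
  \int[lebesgue_measure]_(t in `[0, T]) speed g v t.

Definition sr_dist (X Y : mx) : \bar R :=
  ereal_inf [set l : \bar R | exists T g v,
    [/\ horizontal_curve T g v, g 0 = X, g T = Y &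
        l = (curve_length T g v)%:E]].

Definition sr_geodesic (T : R) (g v : R -> mx) : Prop :=
  horizontal_curve T g v /\
  (curve_length T g v)%:E = sr_dist (g 0) (g T).

Definition arclength_geodesic (T : R) (g v : R -> mx) : Prop :=
  sr_geodesic T g v /\ (forall t, t \in `[0, T] -> speed g v t = 1).

(* Some nontrivial geodesic from [X] reaches [Y] and has no continuation
   beyond [Y] that is still distance minimizing.  The arclength
   parametrization rules out prolonging a geodesic by standing still. *)
Definition geodesic_loses_optimality (X Y : mx) : Prop :=
  exists T g v,
    [/\ 0 < T, arclength_geodesic T g v, g 0 = X, g T = Y &
        ~ exists T' g' v',
          [/\ T < T', arclength_geodesic T' g' v' &
              forall t, t \in `[0, T] -> g' t = g t]].

(* A geodesic is optimal for a positive time, so the base point [X] is never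
   reached at the end of a nontrivial one.  It is counted in its own cut locus
   exactly when geodesics from [X] lose optimality arbitrarily close to [X]
   (in contrast with the Riemannian case, where this never happens). *)
Definition sr_cut_locus (X : mx) : set mx :=
  [set Y | geodesic_loses_optimality X Y \/
    (Y = X /\ forall e : R, 0 < e ->
       exists2 Z, geodesic_loses_optimality X Z & (sr_dist X Z < e%:E)%E)].

End Metric.

Lemma trace_ip_biinvariant : biinvariant_inner_product trace_ip.
Proof.
have ReD (x y : R[i]) : complex.Re (x + y) = complex.Re x + complex.Re y.
  by case: x y => [? ?] [].
split.
- move=> a A B D _ _ _; rewrite /trace_ip mulmxDl -scalemxAl mxtraceD mxtraceZ.
  by case: (\tr (A *m D)) (\tr (B *m D)) => [x y] [x' y'] /=; lra.
- by move=> A B _ _; rewrite /trace_ip mxtrace_mulC.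
- move=> A [Ah _] A0; rewrite /trace_ip -[in X in _ *m X](opprK A) -Ah mulmxN.
  rewrite raddfN.
  have Re_sum : complex.Re (\tr (A *m A ^t*)) =
      \sum_i \sum_j (complex.Re (A i j) ^+ 2 + complex.Im (A i j) ^+ 2).
    rewrite (big_morph (@complex.Re R) ReD (erefl : complex.Re 0 = 0 :> R)).
    apply: eq_bigr => i _; rewrite mxE.
    rewrite (big_morph (@complex.Re R) ReD (erefl : complex.Re 0 = 0 :> R)).
    apply: eq_bigr => j _; rewrite !mxE.
    by case: (A i j) => x y /=; ring.
  have Re_opp (x : R[i]) : complex.Re (- x) = - complex.Re x by case: x.
  rewrite Re_opp mulNr opprK Re_sum divr_gt0//.
  have [i [j Aij]] : exists i j, A i j != 0.
    apply: contra_notP (negP A0) => nA; apply/eqP/matrixP => i j; rewrite mxE.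
    by apply/eqP; apply: contra_notT nA => ?; exists i, j.
  have sq_ge0 (x y : R) : 0 <= x ^+ 2 + y ^+ 2 by rewrite addr_ge0 ?sqr_ge0.
  rewrite (bigD1 i)//= (bigD1 j)//= ltr_pwDl//; last first.
    by rewrite sumr_ge0// => k _; rewrite sumr_ge0.
  rewrite ltr_pwDl ?sumr_ge0// lt0r sq_ge0 andbT.
  rewrite paddr_eq0 ?sqr_ge0// !sqrf_eq0.
  by move: Aij; rewrite eq_complex.
- move=> X A B [/unitarymx_unit Xu _] _ _; rewrite /trace_ip.
  rewrite -!mulmxA (mulmxA (invmx X) X) mulVmx// mul1mx mxtrace_mulC.
  by rewrite -!mulmxA mulVmx// mulmx1.
Qed.

End SU2.

(* Main.v *)
(** Write the first row of a point of SU(2) as (z, w), so that SU(2) is the unit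
    3-sphere, and let k be the Euclidean norm of the horizontal vectors of unit
    length.  If X is a horizontal curve parametrized by arclength, the curve
    [e^(- A t) X(t)] with A = diag (i a, - i a) has constant speed [om] in the
    3-sphere, [om ^ 2 = a ^ 2 + k ^ 2], because A is orthogonal to the
    horizontal velocities.  Hence the spherical distance from 1 to
    [e^(- A T) X(T)] is at most [om T] for every a, with equality for the
    extremal [e^(A t) e^((- A + P) t)] as long as [om T <= pi].  Rescaling a to
    the length of a competitor shows that extremals minimize up to time
    [pi / om], when they reach the diagonal; the equality case of the bound
    shows that they are the only minimizers to their nondiagonal points, and
    that no minimizer has a diagonal point in its interior.  Every point other
    than 1 is reached by an extremal in this range, by the intermediate value
    theorem applied to the phase of z. *)

Require Import Defs.
From mathcomp Require Import all_boot all_order all_algebra spectral.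
From mathcomp Require Import complex ring lra.
From mathcomp Require Import all_classical all_reals all_analysis.

Set Implicit Arguments.
Unset Strict Implicit.
Unset Printing Implicit Defensive.

Import Order.TTheory GRing.Theory Num.Theory.
Import numFieldNormedType.Exports.

Local Open Scope classical_set_scope.
Local Open Scope ring_scope.

(** * Estimates for the arc cosine *)

Section RealAnalysis.
Variable R : realType.
Implicit Types (f g x S : R -> R) (a b k t : R).

Lemma within_continuousM (A : set R) f g :
  {within A, continuous f} -> {within A, continuous g} ->
  {within A, continuous (fun t => f t * g t)}.
Proof. by move=> cf cg t; apply: cvgM; [exact: cf|exact: cg]. Qed.

Lemma within_continuousMl (A : set R) k f :
  {within A, continuous f} -> {within A, continuous (fun t => k * f t)}.
Proof. by move=> cf; apply: within_continuousM => // t; exact: cvg_cst. Qed.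

Lemma within_continuousMr (A : set R) k f :
  {within A, continuous f} -> {within A, continuous (fun t => f t * k)}.
Proof. by move=> cf; apply: within_continuousM => // t; exact: cvg_cst. Qed.

Lemma is_deriveMl k f t df :
  is_derive t 1 f df -> is_derive t 1 (fun t => k * f t) (k * df).
Proof. by move=> Df; apply: is_deriveZ. Qed.

Lemma within_continuous_comp_continuous (A : set R) f g :
  continuous f -> {within A, continuous g} ->
  {within A, continuous (fun t => f (g t))}.
Proof. by move=> cf; apply: within_continuous_comp => y _; exact: cf. Qed.

(** As the inverse of the continuous function [cos] on [[0, pi]], [acos] is continuous up to the
    endpoints -1 and 1. *)
Lemma acos_continuous_itvcc : {within `[(-1 : R), 1], continuous (@acos R)}.
Proof.
rewrite -cospi -(@cos0 R); apply: segment_can_ge_continuous; last exact: cosK.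
- exact: pi_ge0.
- exact/continuous_subspaceT/continuous_cos.
Qed.

(** For [k] in [[0, 1]] the point [k a] stays in [[-1, 1]], so continuity relative to this interval
    suffices, even when [a] is an endpoint. *)
Lemma acos_scale_cvg a : -1 <= a <= 1 ->
  acos (k * a) @[k --> (1 : R)^'-] --> acos a.
Proof.
move=> a1; have /subspace_continuousP/(_ a) := acos_continuous_itvcc.
rewrite /= in_itv/= => /(_ a1) acosa.
apply: (@cvg_comp _ _ _ (fun k => k * a) (@acos R)); last exact: acosa.
move=> P /= Pa; rewrite /nbhs/=.
have /(_ _ Pa) : k * a @[k --> (1 : R)^'-] --> a.
  rewrite -[X in _ --> X]mul1r.
  by apply: cvgM; [exact: cvg_at_left_filter|exact: cvg_cst].
rewrite !near_simpl /= => Pk; near=> k.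
have : k * a \in `[-1, 1] -> P (k * a) by near: k.
apply; rewrite in_itv/=.
have k0 : 0 <= k by near: k; exact: nbhs_left_ge.
have k1 : k <= 1 by near: k; exact: nbhs_left_le.
by move: a1 => /andP[? ?]; apply/andP; split; nra.
Unshelve. all: by end_near. Qed.

(* [acos] is not differentiable at the points -1 and 1, which [x] may reach:
   the estimate is proved for [acos (k * x)] with [0 < k < 1]. *)
Lemma acos_sub_le x (dx : R -> R) S (dS : R -> R) t1 t2 : t1 <= t2 ->
  {within `[t1, t2], continuous x} -> {within `[t1, t2], continuous S} ->
  (forall t, t \in `]t1, t2[ -> is_derive t 1 x (dx t)) ->
  (forall t, t \in `]t1, t2[ -> is_derive t 1 S (dS t)) ->
  (forall t, t \in `[t1, t2] -> -1 <= x t <= 1) ->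
  (forall t, t \in `]t1, t2[ -> 0 <= dS t) ->
  (forall t, t \in `]t1, t2[ -> dx t ^+ 2 <= dS t ^+ 2 * (1 - x t ^+ 2)) ->
  acos (x t2) - acos (x t1) <= S t2 - S t1.
Proof.
move=> t12 cx cS Dx DS x1 dS0 dxS.
have x12 : -1 <= x t1 <= 1 /\ -1 <= x t2 <= 1.
  by split; apply: x1; rewrite in_itv/= lexx t12.
have kx k t : 0 < k < 1 -> t \in `[t1, t2] -> -1 < k * x t < 1.
  move=> /andP[k0 k1] /x1 /andP[? ?]; apply/andP; split; nra.
have main k : 0 < k < 1 -> acos (k * x t2) - acos (k * x t1) <= S t2 - S t1.
  move=> k01; have /andP[k0 k1] := k01.
  (* The mean value theorem is applied to [F], whose derivative will be shown to be nonnegative. *)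
  pose F t := S t - acos (k * x t).
  pose dF t := dS t - (- (Num.sqrt (1 - (k * x t) ^+ 2))^-1) * (k * dx t).
  move: t12; rewrite le_eqVlt => /predU1P[<-|t12]; first by rewrite !subrr.
  have [t tt||c ct Fc] := @MVT R F dF t1 t2 t12.
  - have tcc : t \in `[t1, t2] by apply: subset_itv_oo_cc tt.
    apply: is_deriveB; first exact: DS.
    apply: (@is_derive1_comp _ (@acos R) (fun t => k * x t)).
      by apply: is_derive1_acos; exact: kx.
    have Dxt := Dx _ tt.
    exact: is_deriveMl.
  - apply: within_continuousB => //.
    apply: (@within_continuous_comp _ _ _ _ (fun t => k * x t) (@acos R)).
      move=> y; rewrite inE => -[t tt <-]; apply: continuous_acos; exact: kx.
    exact: within_continuousMl.
  - suff : 0 <= dF c * (t2 - t1) by rewrite -Fc /F; lra.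
    apply: mulr_ge0; last by rewrite subr_ge0 ltW.
    have ccc : c \in `[t1, t2] by apply: subset_itv_oo_cc ct.
    have /andP[kx1 kx2] := kx _ _ k01 ccc.
    have /andP[xc1 xc2] := x1 _ ccc.
    have dSc := dS0 _ ct; have dxc := dxS _ ct.
    have r0 : 0 < 1 - (k * x c) ^+ 2 by nra.
    have s0 : 0 < Num.sqrt (1 - (k * x c) ^+ 2) by rewrite sqrtr_gt0.
    have ss := sqr_sqrtr (ltW r0).
    (* After multiplication by the positive square root, the claim bounds [- k dx] by the root times
       [dS]; it follows by comparing squares. *)
    rewrite /dF mulNr opprK -(pmulr_rge0 _ s0) mulrDr mulrA mulfV ?gt_eqF// mul1r.
    have : (k * dx c) ^+ 2 <= (Num.sqrt (1 - (k * x c) ^+ 2) * dS c) ^+ 2.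
      rewrite [leRHS]exprMn ss.
      have : k ^+ 2 * dx c ^+ 2 <= k ^+ 2 * (dS c ^+ 2 * (1 - x c ^+ 2)).
        by rewrite ler_pM2l// exprn_gt0.
      (* This is the gap between [k^2 (1 - x^2)] and [1 - k^2 x^2], times [dS^2]. *)
      have : 0 <= dS c ^+ 2 * (1 - k ^+ 2).
        by rewrite mulr_ge0 ?sqr_ge0// subr_ge0 expr_le1// ltW.
      by rewrite !exprMn; lra.
    rewrite -ler_sqrt ?sqr_ge0// !sqrtr_sqr (ger0_norm (mulr_ge0 (ltW s0) dSc)).
    by rewrite ler_norml => /andP[? _]; lra.
(* The scaling is removed by letting [k] tend to 1 from the left. *)
have /ler_cvg_to : acos (k * x t2) - acos (k * x t1) @[k --> (1 : R)^'-] -->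
    acos (x t2) - acos (x t1).
  by apply: cvgB; apply: acos_scale_cvg; case: x12.
apply.
- exact: cvg_cst.
- near=> k; apply: main; apply/andP; split; near: k.
    exact: nbhs_left_gt.
  exact: nbhs_left_lt.
Unshelve. all: by end_near. Qed.
End RealAnalysis.

(** * Curves on the 3-sphere in a rotating frame *)

Section SphereCurves.
Variable R : realType.
Implicit Types (a t T : R).

(** The fundamental theorem of calculus for the integral from 0. Applied to the speed of a curve, it
    provides the arc length function. *)
Lemma continuous_primitive (f : R -> R) T : 0 <= T ->
  {within `[0, T], continuous f} ->
  exists S : R -> R, [/\ {within `[0, T], continuous S},
    forall t, t \in `]0, T[ -> is_derive t 1 S (f t),
    S 0 = 0 & S T = \int[lebesgue_measure]_(t in `[0, T]) f t].
Proof.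
move=> T0 cf; exists (fun x => parameterized_integral lebesgue_measure 0 x f).
have fi : lebesgue_measure.-integrable `[0, T] (EFin \o f).
  by apply: continuous_compact_integrable => //; exact: segment_compact.
split=> [|t||//].
- exact: parameterized_integral_continuous.
- rewrite in_itv/= => /andP[t0 tT].
  have cft : {for t, continuous f}.
    apply: (within_continuous_continuous _ cf); rewrite ?in_itv/= ?t0//.
    exact: lt_trans tT.
  have [dF dFE] := continuous_FTC1_closed tT fi t0 cft.
  by have := derivableP dF; rewrite -derive1E dFE.
- by rewrite /parameterized_integral set_itv1 Rintegral_set1.
Qed.

(* The component of a velocity [d] along a unit vector [e]: only the part of
   [e] tangent to the sphere at [u] contributes. *)
Lemma tangent_dot_le (u0 u1 u2 u3 d0 d1 d2 d3 e0 e1 e2 e3 : R) :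
  u0 ^+ 2 + u1 ^+ 2 + u2 ^+ 2 + u3 ^+ 2 = 1 ->
  e0 ^+ 2 + e1 ^+ 2 + e2 ^+ 2 + e3 ^+ 2 = 1 ->
  u0 * d0 + u1 * d1 + u2 * d2 + u3 * d3 = 0 ->
  (d0 * e0 + d1 * e1 + d2 * e2 + d3 * e3) ^+ 2 <=
  (d0 ^+ 2 + d1 ^+ 2 + d2 ^+ 2 + d3 ^+ 2) *
  (1 - (u0 * e0 + u1 * e1 + u2 * e2 + u3 * e3) ^+ 2).
Proof.
move=> u_1 e_1 ud; set m := u0 * e0 + u1 * e1 + u2 * e2 + u3 * e3.
(* [f] is the part of [e] orthogonal to [u]; its squared norm is [1 - m^2]. *)
pose f0 := e0 - m * u0; pose f1 := e1 - m * u1.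
pose f2 := e2 - m * u2; pose f3 := e3 - m * u3.
have -> : d0 * e0 + d1 * e1 + d2 * e2 + d3 * e3 =
    d0 * f0 + d1 * f1 + d2 * f2 + d3 * f3.
  transitivity (d0 * f0 + d1 * f1 + d2 * f2 + d3 * f3
    + m * (u0 * d0 + u1 * d1 + u2 * d2 + u3 * d3)).
    by rewrite /f0 /f1 /f2 /f3; ring.
  by rewrite ud; ring.
have -> : 1 - m ^+ 2 = f0 ^+ 2 + f1 ^+ 2 + f2 ^+ 2 + f3 ^+ 2.
  have -> : f0 ^+ 2 + f1 ^+ 2 + f2 ^+ 2 + f3 ^+ 2 =
      (e0 ^+ 2 + e1 ^+ 2 + e2 ^+ 2 + e3 ^+ 2)
      + m ^+ 2 * (u0 ^+ 2 + u1 ^+ 2 + u2 ^+ 2 + u3 ^+ 2)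
      - 2 * m * (u0 * e0 + u1 * e1 + u2 * e2 + u3 * e3).
    by rewrite /f0 /f1 /f2 /f3; ring.
  by rewrite e_1 u_1 -/m; ring.
rewrite -subr_ge0.
(* Lagrange's identity: the defect in the Cauchy-Schwarz inequality is a sum of squares. *)
have -> : (d0 ^+ 2 + d1 ^+ 2 + d2 ^+ 2 + d3 ^+ 2) *
    (f0 ^+ 2 + f1 ^+ 2 + f2 ^+ 2 + f3 ^+ 2)
    - (d0 * f0 + d1 * f1 + d2 * f2 + d3 * f3) ^+ 2 =
  (d0 * f1 - d1 * f0) ^+ 2 + (d0 * f2 - d2 * f0) ^+ 2
  + (d0 * f3 - d3 * f0) ^+ 2 + (d1 * f2 - d2 * f1) ^+ 2
  + (d1 * f3 - d3 * f1) ^+ 2 + (d2 * f3 - d3 * f2) ^+ 2 by ring.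
by rewrite !addr_ge0 ?sqr_ge0.
Qed.

(** Expand the squared norms of [u - e] and [u + e], which are nonnegative. *)
Lemma unit_dot_bound (u0 u1 u2 u3 e0 e1 e2 e3 : R) :
  u0 ^+ 2 + u1 ^+ 2 + u2 ^+ 2 + u3 ^+ 2 = 1 ->
  e0 ^+ 2 + e1 ^+ 2 + e2 ^+ 2 + e3 ^+ 2 = 1 ->
  -1 <= u0 * e0 + u1 * e1 + u2 * e2 + u3 * e3 <= 1.
Proof.
move=> u_1 e_1.
have : 0 <= (u0 - e0) ^+ 2 + (u1 - e1) ^+ 2 + (u2 - e2) ^+ 2 + (u3 - e3) ^+ 2.
  by rewrite !addr_ge0 ?sqr_ge0.
have : 0 <= (u0 + e0) ^+ 2 + (u1 + e1) ^+ 2 + (u2 + e2) ^+ 2 + (u3 + e3) ^+ 2.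
  by rewrite !addr_ge0 ?sqr_ge0.
by rewrite !sqrrD !sqrrN => ? ?; apply/andP; split; lra.
Qed.

(* [unspin c s p q] is the real part of [e^(-i theta) (p + i q)] and
   [unspin c s q (- p)] its imaginary part, where [c = cos theta], [s = sin theta]. *)
Definition unspin (c s p q : R) := p * c + q * s.

(* The inner product in R^4 of [(e0, e1, e2, e3)] with [e^(-i th) (z, w)],
   where [z = p + i q] and [w = r + i s]. *)
Definition spin_dot (th p q r s e0 e1 e2 e3 : R) :=
  let c := cos th in let w := sin th in
  unspin c w p q * e0 + unspin c w q (- p) * e1 +
  unspin c w r s * e2 + unspin c w s (- r) * e3.

Lemma is_derive_unspin (p q th : R -> R) t dp dq dth :
  is_derive t 1 p dp -> is_derive t 1 q dq -> is_derive t 1 th dth ->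
  is_derive t 1 (fun t => unspin (cos (th t)) (sin (th t)) (p t) (q t))
    (unspin (cos (th t)) (sin (th t)) (dp + dth * q t) (dq - dth * p t)).
Proof.
move=> Dp Dq Dth; rewrite /unspin.
have Dc : is_derive t 1 (fun t => cos (th t)) (- sin (th t) * dth).
  exact: is_derive1_comp.
have Ds : is_derive t 1 (fun t => sin (th t)) (cos (th t) * dth).
  exact: is_derive1_comp.
apply: is_derive_eq; rewrite -![_ *: _]/(_ * _).
by ring.
Qed.

Lemma within_continuous_unspin (A : set R) (p q th : R -> R) :
  {within A, continuous p} -> {within A, continuous q} ->
  {within A, continuous th} ->
  {within A, continuous (fun t => unspin (cos (th t)) (sin (th t)) (p t) (q t))}.
Proof.
move=> cp cq cth; apply: within_continuousD; apply: within_continuousM => //;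
apply: within_continuous_comp_continuous => //;
  [exact: continuous_cos|exact: continuous_sin].
Qed.

Variables (T : R) (p q r s dp dq dr ds : R -> R).
Hypothesis Cp : C1_real T p dp.
Hypothesis Cq : C1_real T q dq.
Hypothesis Cr : C1_real T r dr.
Hypothesis Cs : C1_real T s ds.
Hypothesis unit_pqrs : forall t, t \in `[0, T] ->
  p t ^+ 2 + q t ^+ 2 + r t ^+ 2 + s t ^+ 2 = 1.
Hypothesis tangent_pqrs : forall t, t \in `[0, T] ->
  p t * dp t + q t * dq t + r t * dr t + s t * ds t = 0.
Hypothesis horizontal_pqrs : forall t, t \in `[0, T] ->
  q t * dp t - p t * dq t + s t * dr t - r t * ds t = 0.

(* In the frame rotating with angle [a * S t], a horizontal curve moves on the
   unit 3-sphere with speed at most [om * S'], because the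
   rotation is orthogonal to horizontal velocities. *)
Lemma rotating_frame_angle_le (S dS : R -> R) (a k om e0 e1 e2 e3 t1 t2 : R) :
  0 <= om -> om ^+ 2 = a ^+ 2 + k ^+ 2 ->
  {within `[0, T], continuous S} ->
  (forall t, t \in `]0, T[ -> is_derive t 1 S (dS t)) ->
  (forall t, t \in `]0, T[ -> 0 <= dS t) ->
  (forall t, t \in `]0, T[ ->
     dp t ^+ 2 + dq t ^+ 2 + dr t ^+ 2 + ds t ^+ 2 <= (k * dS t) ^+ 2) ->
  e0 ^+ 2 + e1 ^+ 2 + e2 ^+ 2 + e3 ^+ 2 = 1 ->
  0 <= t1 -> t1 <= t2 -> t2 <= T ->
  forall x : R -> R, x =
    (fun t => spin_dot (a * S t) (p t) (q t) (r t) (s t) e0 e1 e2 e3) ->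
  acos (x t2) - acos (x t1) <= om * (S t2 - S t1).
Proof.
move=> om0 om2 cS DS dS0 speed e_1 t10 t12 t2T x xE.
have sub_cc : `[t1, t2] `<=` `[0, T] by apply: subset_itv; rewrite bnd_simp.
have sub_oo : `]t1, t2[ `<=` `]0, T[ by apply: subset_itv; rewrite bnd_simp.
have [cp _ Dp] := Cp; have [cq _ Dq] := Cq.
have [cr _ Dr] := Cr; have [cs _ Ds] := Cs.
pose c t := cos (a * S t); pose w t := sin (a * S t).
have cw t : c t ^+ 2 + w t ^+ 2 = 1 by exact: cos2Dsin2.
have caS : {within `[0, T], continuous (fun t => a * S t)}.
  exact: within_continuousMl.
(* [d0], ..., [d3] are the derivatives of the four coordinates in the rotating frame. *)
pose d0 t := unspin (c t) (w t) (dp t + a * dS t * q t) (dq t - a * dS t * p t).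
pose d1 t := unspin (c t) (w t) (dq t + a * dS t * - p t) (- dp t - a * dS t * q t).
pose d2 t := unspin (c t) (w t) (dr t + a * dS t * s t) (ds t - a * dS t * r t).
pose d3 t := unspin (c t) (w t) (ds t + a * dS t * - r t) (- dr t - a * dS t * s t).
have unit_unspin t : t \in `[0, T] ->
  unspin (c t) (w t) (p t) (q t) ^+ 2 + unspin (c t) (w t) (q t) (- p t) ^+ 2 +
  unspin (c t) (w t) (r t) (s t) ^+ 2 + unspin (c t) (w t) (s t) (- r t) ^+ 2 = 1.
  move=> /unit_pqrs u1; transitivity ((c t ^+ 2 + w t ^+ 2) *
    (p t ^+ 2 + q t ^+ 2 + r t ^+ 2 + s t ^+ 2)); last by rewrite u1 cw mulr1.
  by rewrite /unspin; ring.
have -> : om * (S t2 - S t1) = om * S t2 - om * S t1 by ring.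
have angle_le := @acos_sub_le R x
  (fun t => d0 t * e0 + d1 t * e1 + d2 t * e2 + d3 t * e3)
  (fun t => om * S t) (fun t => om * dS t) t1 t2 t12.
eapply angle_le.
- apply: (continuous_subspaceW sub_cc).
  have cN f : {within `[0, T], continuous f} ->
    {within `[0, T], continuous (fun t : R => - f t : R)}.
    by move=> cf t; apply: cvgN; exact: cf.
  rewrite xE /spin_dot.
  have cpN := cN _ cp; have crN := cN _ cr.
  apply: within_continuousD; last first.
    exact/within_continuousMr/within_continuous_unspin.
  apply: within_continuousD; last first.
    exact/within_continuousMr/within_continuous_unspin.
  by apply: within_continuousD;
    exact/within_continuousMr/within_continuous_unspin.
- apply: (continuous_subspaceW sub_cc).
  exact: within_continuousMl.
- move=> t /sub_oo tT.
  have Dpt := Dp _ tT; have Dqt := Dq _ tT.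
  have Drt := Dr _ tT; have Dst := Ds _ tT; have DSt := DS _ tT.
  have DaS : is_derive t 1 (fun t => a * S t) (a * dS t).
    exact: is_deriveMl.
  have Dmp : is_derive t 1 (fun t => - p t) (- dp t) by exact: is_deriveN.
  have Dmr : is_derive t 1 (fun t => - r t) (- dr t) by exact: is_deriveN.
  have D0 := is_derive_unspin Dpt Dqt DaS.
  have D1 := is_derive_unspin Dqt Dmp DaS.
  have D2 := is_derive_unspin Drt Dst DaS.
  have D3 := is_derive_unspin Dst Dmr DaS.
  rewrite xE /spin_dot.
  apply: is_derive_eq; rewrite -![_ *: _]/(_ * _) /d0 /d1 /d2 /d3 /c /w.
  by ring.
- by move=> t /sub_oo tT; apply: is_deriveMl; exact: DS.
- by move=> t /sub_cc tT; rewrite xE; apply: unit_dot_bound => //; exact: unit_unspin.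
- by move=> t /sub_oo /dS0 ?; rewrite mulr_ge0.
- move=> t /sub_oo tT.
  have tTc : t \in `[0, T] by apply: subset_itv_oo_cc tT.
  have u_1 := unit_pqrs tTc.
  have ud := tangent_pqrs tTc; have uh := horizontal_pqrs tTc.
  rewrite xE; apply: le_trans (tangent_dot_le (unit_unspin _ tTc) e_1 _) _.
    (* The velocity stays tangent to the sphere, since the rotation adds a term orthogonal to the
       position. *)
    rewrite /d0 /d1 /d2 /d3.
    transitivity ((c t ^+ 2 + w t ^+ 2) *
      (p t * dp t + q t * dq t + r t * dr t + s t * ds t)).
      by rewrite /unspin; ring.
    by rewrite ud mulr0.
  apply: ler_wpM2r.
    rewrite subr_ge0 -[leRHS](expr1n _ 2) -ler_sqrt ?expr1n// sqrtr1 sqrtr_sqr.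
    by rewrite ler_norml; apply: unit_dot_bound => //; exact: unit_unspin.
  (* In the squared speed the cross term is the horizontality condition, hence zero; what remains is
     at most [(a^2 + k^2) dS^2 = om^2 dS^2]. *)
  have -> : d0 t ^+ 2 + d1 t ^+ 2 + d2 t ^+ 2 + d3 t ^+ 2 =
     (c t ^+ 2 + w t ^+ 2) * (dp t ^+ 2 + dq t ^+ 2 + dr t ^+ 2 + ds t ^+ 2
       + (a * dS t) ^+ 2 * (p t ^+ 2 + q t ^+ 2 + r t ^+ 2 + s t ^+ 2)
       + 2 * (a * dS t) *
         (q t * dp t - p t * dq t + s t * dr t - r t * ds t)).
    by rewrite /d0 /d1 /d2 /d3 /unspin; ring.
  rewrite cw u_1 uh [leRHS]exprMn om2; have := speed _ tT; rewrite !exprMn; lra.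
Qed.

End SphereCurves.

(** * Coordinates on SU(2) *)

Section Coordinates.
Local Open Scope complex_scope.
Local Open Scope sesquilinear_scope.
Variable R : realType.
Local Notation mx := ('M[R[i]]_2).
Local Notation Re := (@complex.Re R).
Local Notation Im := (@complex.Im R).
Implicit Types (p q r s t T : R) (X : mx).

(** The matrix of the quaternion with coordinates [p, q, r, s]: its rows are [(z, w)] and
    [(- conj w, conj z)] with [z = p + i q] and [w = r + i s]. *)
Definition su2mx p q r s : mx := \matrix_(i, j)
  if i == 0 then (if j == 0 then p +i* q else r +i* s)
  else (if j == 0 then (- r) +i* s else p +i* (- q)).

Lemma ord2P (i : 'I_2) : i = 0 \/ i = 1.
Proof. by case: i => -[|[|//]] ?; [left|right]; apply/val_inj. Qed.

Lemma mx2P (A B : mx) : A 0 0 = B 0 0 -> A 0 1 = B 0 1 -> A 1 0 = B 1 0 ->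
  A 1 1 = B 1 1 -> A = B.
Proof.
by move=> *; apply/matrixP => i j; case: (ord2P i) => ->; case: (ord2P j) => ->.
Qed.

Lemma mulmx2E (A B : mx) i j : (A *m B) i j = A i 0 * B 0 j + A i 1 * B 1 j.
Proof.
rewrite mxE 2!big_ord_recl big_ord0 addr0.
by congr (_ + A i _ * B _ j); apply/val_inj.
Qed.

Lemma det_mx2 (A : mx) : \det A = A 0 0 * A 1 1 - A 0 1 * A 1 0.
Proof.
rewrite (expand_det_row _ 0) 2!big_ord_recl big_ord0 addr0 /cofactor !det_mx11.
rewrite !mxE /= expr0 expr1 mul1r mulN1r mulrN.
by congr (A _ _ * A _ _ - A _ _ * A _ _); apply/val_inj.
Qed.

Lemma trC2E (A : mx) i j : (A ^t*) i j = conjc (A j i).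
Proof. by rewrite !mxE. Qed.

Lemma tr_mx2 (A : mx) : \tr A = A 0 0 + A 1 1.
Proof.
rewrite /mxtrace 2!big_ord_recl big_ord0 addr0.
by congr (_ + A _ _); apply/val_inj.
Qed.

Lemma su2mx_coordsE X : SU2 X ->
  X = su2mx (Re (X 0 0)) (Im (X 0 0)) (Re (X 0 1)) (Im (X 0 1)) /\
  Re (X 0 0) ^+ 2 + Im (X 0 0) ^+ 2 + Re (X 0 1) ^+ 2 + Im (X 0 1) ^+ 2 = 1.
Proof.
move=> [/unitarymxP Xu]; rewrite det_mx2 => detX.
have E i j : X i 0 * conjc (X j 0) + X i 1 * conjc (X j 1) = (i == j)%:R.
  by rewrite -!trC2E -mulmx2E Xu mxE.
have E00 := E 0 0; have E01 := E 0 1; have E10 := E 1 0.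
(* Multiply by the squared norm 1 of the first row, then use the orthogonality of the rows and the
   determinant. *)
have conj00 : X 1 1 = conjc (X 0 0).
  transitivity (X 1 1 * (X 0 0 * conjc (X 0 0) + X 0 1 * conjc (X 0 1))).
    by rewrite E00 mulr1.
  transitivity (conjc (X 0 0) * (X 0 0 * X 1 1 - X 0 1 * X 1 0) +
    X 0 1 * (X 1 0 * conjc (X 0 0) + X 1 1 * conjc (X 0 1))); first by ring.
  by rewrite detX E10 mulr1 mulr0 addr0.
have conj01 : X 1 0 = - conjc (X 0 1).
  transitivity (X 1 0 * (X 0 0 * conjc (X 0 0) + X 0 1 * conjc (X 0 1))).
    by rewrite E00 mulr1.
  transitivity (- conjc (X 0 1) * (X 0 0 * X 1 1 - X 0 1 * X 1 0) +
    X 0 0 * (X 1 0 * conjc (X 0 0) + X 1 1 * conjc (X 0 1))); first by ring.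
  by rewrite detX E10 mulr1 mulr0 addr0.
split.
  apply: mx2P; rewrite ?conj00 ?conj01 mxE /=.
  - by case: (X 0 0).
  - by case: (X 0 1).
  - by case: (X 0 1) => ? ?; apply/eqP; rewrite eq_complex /= opprK !eqxx.
  - by case: (X 0 0).
move: E00; case: (X 0 0) (X 0 1) => a b [c d] /= /eqP; rewrite eq_complex /=.
by move=> /andP[/eqP + _] => <-; ring.
Qed.

Lemma su2mxE p q r s : [/\ su2mx p q r s 0 0 = p +i* q,
  su2mx p q r s 0 1 = r +i* s, su2mx p q r s 1 0 = (- r) +i* s
  & su2mx p q r s 1 1 = p +i* (- q)].
Proof. by rewrite !mxE. Qed.

Lemma SU2_su2mx p q r s : p ^+ 2 + q ^+ 2 + r ^+ 2 + s ^+ 2 = 1 ->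
  SU2 (su2mx p q r s).
Proof.
move=> u1; have [E00 E01 E10 E11] := su2mxE p q r s; split.
  apply/unitarymxP; apply: mx2P; rewrite mulmx2E !trC2E ?E00 ?E01 ?E10 ?E11 mxE /=;
    apply/eqP; rewrite eq_complex /=; apply/andP; split; apply/eqP; lra.
by rewrite det_mx2 E00 E01 E10 E11; apply/eqP; rewrite eq_complex /=;
  apply/andP; split; apply/eqP; lra.
Qed.

Lemma su2mx1 : 1%:M = su2mx 1 0 0 0.
Proof.
by apply: mx2P; rewrite !mxE //=; apply/eqP; rewrite eq_complex /= ?oppr0 !eqxx.
Qed.

Lemma is_diag_mx2 X : is_diag_mx X <-> X 0 1 = 0 /\ X 1 0 = 0.
Proof.
split=> [/is_diag_mxP Xd|[X01 X10]]; first by split; apply: Xd.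
by apply/is_diag_mxP => i j; case: (ord2P i) => ->; case: (ord2P j) => ->.
Qed.

Lemma SU2_diagE X : SU2 X -> SU2_diag X <-> X 0 1 = 0.
Proof.
move=> XS; split=> [[_ /is_diag_mx2[]//]|X01]; split=> //.
have [-> _] := su2mx_coordsE XS; apply/is_diag_mx2.
by rewrite !mxE /= X01; split=> //; apply/eqP; rewrite eq_complex /= oppr0 !eqxx.
Qed.

Lemma invmx_su2mx p q r s : p ^+ 2 + q ^+ 2 + r ^+ 2 + s ^+ 2 = 1 ->
  invmx (su2mx p q r s) = su2mx p (- q) (- r) (- s).
Proof.
move=> u1; have [Xu _] := SU2_su2mx u1; rewrite invmx_unitary//.
by apply: mx2P; rewrite trC2E !mxE /= ?opprK.
Qed.

Lemma su2_su2mx q r s : su2 (su2mx 0 q r s).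
Proof.
split; last first.
  rewrite tr_mx2 !mxE /=; apply/eqP.
  by rewrite eq_complex /= addr0 subrr !eqxx.
by apply: mx2P; rewrite trC2E !mxE; apply/eqP;
  rewrite eq_complex /= ?oppr0 ?opprK !eqxx.
Qed.

Lemma su2_antidiagP X : su2_antidiag X <-> exists r s, X = su2mx 0 0 r s.
Proof.
split=> [[[Xh _] Xa]|[r [s ->]]]; last first.
  split; first exact: su2_su2mx.
  move=> i j; case: (ord2P i) => ->; case: (ord2P j) => -> //= _; rewrite !mxE /=.
    by [].
  by rewrite oppr0.
exists (Re (X 0 1)), (Im (X 0 1)).
have := congr1 (fun A : mx => A 1 0) Xh; rewrite trC2E mxE => X10.
have X00 : X 0 0 = 0 by apply: Xa.
have X11 : X 1 1 = 0 by apply: Xa.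
apply: mx2P; rewrite !mxE /= ?X00 ?X11 ?oppr0 //; first by case: (X 0 1).
rewrite -[X 1 0]opprK -X10; case: (X 0 1) => a b /=.
by apply/eqP; rewrite eq_complex /= opprK !eqxx.
Qed.

End Coordinates.

(** * Horizontal velocities and the invariant metric in coordinates *)

Section HorizontalCurves.
Local Open Scope complex_scope.
Variable R : realType.
Local Notation mx := ('M[R[i]]_2).
Local Notation Re := (@complex.Re R).
Local Notation Im := (@complex.Im R).
Implicit Types (a k p q r s t T : R) (X V : mx) (g v : R -> mx).

Definition row_norm2 V :=
  Re (V 0 0) ^+ 2 + Im (V 0 0) ^+ 2 + Re (V 0 1) ^+ 2 + Im (V 0 1) ^+ 2.

(** Write [V = B X] with [B] antidiagonal. The first row of [V] is orthogonal to that of [X] because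
    [B] is skew-Hermitian, and to that of [diag (i, - i) X] because [B] has no diagonal part; right
    multiplication by [X] preserves norms. *)
Lemma horizontal_coords X V : SU2 X -> su2_antidiag (V *m invmx X) ->
  [/\ Re (X 0 0) * Re (V 0 0) + Im (X 0 0) * Im (V 0 0) +
        Re (X 0 1) * Re (V 0 1) + Im (X 0 1) * Im (V 0 1) = 0,
      Im (X 0 0) * Re (V 0 0) - Re (X 0 0) * Im (V 0 0) +
        Im (X 0 1) * Re (V 0 1) - Re (X 0 1) * Im (V 0 1) = 0 &
      exists r s, V *m invmx X = su2mx 0 0 r s /\ row_norm2 V = r ^+ 2 + s ^+ 2].
Proof.
move=> XS /su2_antidiagP[b1 [b2 VE]].
have [XE X1] := su2mx_coordsE XS.
have Xu : X \in unitmx by have [/unitarymx_unit] := XS.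
rewrite /row_norm2; set p := Re (X 0 0) in XE X1 *; set q := Im (X 0 0) in XE X1 *.
set r := Re (X 0 1) in XE X1 *; set s := Im (X 0 1) in XE X1 *.
have -> : V = su2mx 0 0 b1 b2 *m su2mx p q r s by rewrite -XE -VE mulmxKV.
rewrite !mulmx2E !mxE /=.
split; try (by ring); exists b1, b2; split; first by rewrite -VE -XE mulmxK.
rewrite -[RHS]mulr1 -X1; ring.
Qed.

Lemma su2mx0 : su2mx 0 0 0 0 = 0 :> mx.
Proof. by apply: mx2P; rewrite !mxE //= oppr0. Qed.

(* Conjugation by [diag (e^(i pi / 4), e^(- i pi / 4))] is a quarter turn of
   the plane of antidiagonal matrices, so an invariant inner product restricts
   there to a multiple of the Euclidean one. *)
Lemma antidiag_ipE (ip : mx -> mx -> R) : biinvariant_inner_product ip ->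
  exists2 c : R, 0 < c &
    forall r s, ip (su2mx 0 0 r s) (su2mx 0 0 r s) = c * (r ^+ 2 + s ^+ 2).
Proof.
case=> ip_lin ip_sym ip_pos ip_ad.
pose E r s : mx := su2mx 0 0 r s.
have ES r s : su2 (E r s) by exact: su2_su2mx.
have linE a r s r' s' D : su2 D ->
    ip (E (a * r + r') (a * s + s')) D = a * ip (E r s) D + ip (E r' s') D.
  move=> DS; rewrite -ip_lin//; congr (ip _ D).
  by apply: mx2P; rewrite !mxE /=; apply/eqP; rewrite eq_complex /=;
    apply/andP; split; apply/eqP; ring.
have lin2 r s D : su2 D -> ip (E r s) D = r * ip (E 1 0) D + s * ip (E 0 1) D.
  move=> DS; have E00 : ip (E 0 0) D = 0.
    by have := linE 1 0 0 0 0 D DS; rewrite !(mul1r, addr0); lra.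
  have := linE r 1 0 0 s D DS; have := linE s 0 1 0 0 D DS.
  by rewrite E00 !(mulr1, mulr0, addr0, add0r) => -> ->.
(* [h = cos (pi / 4) = sin (pi / 4)], so that [su2mx h h 0 0] is the diagonal matrix of the quarter
   turn. *)
pose h : R := Num.sqrt 2^-1.
have h2 : h ^+ 2 = 2^-1 by rewrite sqr_sqrtr// invr_ge0.
have turn r s : su2mx h h 0 0 *m E r s *m invmx (su2mx h h 0 0) = E (- s) r.
  have h1 : h ^+ 2 + h ^+ 2 + 0 ^+ 2 + 0 ^+ 2 = 1 by rewrite h2; lra.
  have hr : h * h * r = r / 2 by rewrite -expr2 h2 mulrC.
  have hs : h * h * s = s / 2 by rewrite -expr2 h2 mulrC.
  rewrite invmx_su2mx//; apply: mx2P; rewrite !(mulmx2E, mxE) /=;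
  apply/eqP; rewrite eq_complex /=; apply/andP; split; apply/eqP; lra.
have hS : SU2 (su2mx h h 0 0) by apply: SU2_su2mx; rewrite h2; lra.
have i11 := ip_ad _ _ _ hS (ES 1 0) (ES 1 0).
have i12 := ip_ad _ _ _ hS (ES 1 0) (ES 0 1).
have s12 := ip_sym _ _ (ES 1 0) (ES 0 1).
rewrite !turn oppr0 in i11 i12.
have s12' := ip_sym _ _ (ES 0 1) (ES (-1) 0).
exists (ip (E 1 0) (E 1 0)).
  apply: ip_pos => //; apply/eqP => /matrixP/(_ 0 1); rewrite !mxE /= => /eqP.
  by rewrite eq_complex /= oner_eq0.
move=> r s; rewrite -/(E r s).
have -> := lin2 r s (E r s) (ES r s).
have -> := ip_sym _ _ (ES 1 0) (ES r s); have -> := lin2 r s _ (ES 1 0).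
have -> := ip_sym _ _ (ES 0 1) (ES r s); have -> := lin2 r s _ (ES 0 1).
(* By the quarter turn and symmetry, this product equals its own opposite. *)
have i21 : ip (E 0 1) (E 1 0) = 0.
  have := lin2 (-1) 0 _ (ES 0 1); rewrite -[ip (E (-1) 0) _]s12' i12; lra.
by rewrite s12 i21 i11; ring.
Qed.

Lemma row_norm2_ge0 V : 0 <= row_norm2 V.
Proof. by rewrite !addr_ge0 ?sqr_ge0. Qed.

(** [k = 1 / sqrt c] is the Euclidean norm of the horizontal vectors of unit length. From here on
    the metric enters only through [k]. *)
Lemma speed_row_norm (ip : mx -> mx -> R) : biinvariant_inner_product ip ->
  exists2 k, 0 < k & forall T g v, horizontal_curve T g v ->
    forall t, t \in `[0, T] -> speed ip g v t = k^-1 * Num.sqrt (row_norm2 (v t)).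
Proof.
move=> /antidiag_ipE[c c0 ipE]; exists (Num.sqrt c)^-1.
  by rewrite invr_gt0 sqrtr_gt0.
move=> T g v gv t tT; rewrite /speed /right_velocity.
have [_ _ [r [s [-> ->]]]] :=
  horizontal_coords (hc_SU2 gv tT) (hc_horizontal gv tT).
by rewrite ipE invrK sqrtrM// ltW.
Qed.

End HorizontalCurves.

(** * Lower bounds for the length *)

Section AngleBounds.
Local Open Scope complex_scope.
Variable R : realType.
Local Notation mx := ('M[R[i]]_2).
Local Notation Re := (@complex.Re R).
Local Notation Im := (@complex.Im R).
Implicit Types (a t T l th : R) (X : mx) (g v : R -> mx).
Variables (ip : mx -> mx -> R) (k : R).
Hypothesis k_gt0 : 0 < k.
Hypothesis speedE : forall T g v, horizontal_curve T g v ->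
  forall t, t \in `[0, T] -> speed ip g v t = k^-1 * Num.sqrt (row_norm2 (v t)).

Definition spin_dotX th X (e0 e1 e2 e3 : R) :=
  spin_dot th (Re (X 0 0)) (Im (X 0 0)) (Re (X 0 1)) (Im (X 0 1)) e0 e1 e2 e3.

Lemma spin_dotX1 th X : spin_dotX th X 1 0 0 0 =
  unspin (cos th) (sin th) (Re (X 0 0)) (Im (X 0 0)).
Proof. by rewrite /spin_dotX /spin_dot !mulr0 !addr0 mulr1. Qed.

Lemma spin_dotX_id th e0 e1 e2 e3 :
  spin_dotX th 1%:M e0 e1 e2 e3 = cos th * e0 - sin th * e1.
Proof. by rewrite /spin_dotX /spin_dot !mxE /= /unspin; ring. Qed.

Lemma spin_dotX_bound th X e0 e1 e2 e3 : SU2 X ->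
  e0 ^+ 2 + e1 ^+ 2 + e2 ^+ 2 + e3 ^+ 2 = 1 ->
  -1 <= spin_dotX th X e0 e1 e2 e3 <= 1.
Proof.
move=> /su2mx_coordsE[_ X1] e_1; apply: unit_dot_bound => //.
transitivity ((cos th ^+ 2 + sin th ^+ 2) * (Re (X 0 0) ^+ 2 + Im (X 0 0) ^+ 2
  + Re (X 0 1) ^+ 2 + Im (X 0 1) ^+ 2)); last by rewrite X1 cos2Dsin2 mulr1.
by rewrite /unspin; ring.
Qed.

Lemma speed_ge0 g v t : 0 <= speed ip g v t.
Proof. exact: sqrtr_ge0. Qed.

Lemma row_norm2_speed T g v t : horizontal_curve T g v -> t \in `[0, T] ->
  row_norm2 (v t) = (k * speed ip g v t) ^+ 2.
Proof.
move=> gv tT; rewrite (speedE gv tT) mulrA mulfV ?gt_eqF// mul1r.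
by rewrite sqr_sqrtr// row_norm2_ge0.
Qed.

Lemma within_continuous_speed T g v : horizontal_curve T g v ->
  {within `[0, T], continuous (speed ip g v)}.
Proof.
move=> gv; have [_ gvC _ _] := gv.
have [[_ cp _] [_ cq _]] := gvC 0 0; have [[_ cr _] [_ cs _]] := gvC 0 1.
apply: (@subspace_eq_continuous _ _ _
  (fun t => k^-1 * Num.sqrt (row_norm2 (v t)))).
  by move=> t; rewrite inE /= => tT; rewrite /from_subspace (speedE gv).
apply: within_continuousMl.
apply: (@within_continuous_comp_continuous R _ (@Num.sqrt R)).
  exact: sqrt_continuous.
by do 3![apply: within_continuousD; last exact: within_continuousM];
   exact: within_continuousM.
Qed.

(** [S] is any parameter growing at least as fast as arc length: it will be a shifted arc length for
    competitors, and time for curves of unit speed. *)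
Lemma horizontal_angle_le T g v (S dS : R -> R) a om e0 e1 e2 e3 t1 t2 :
  horizontal_curve T g v ->
  0 <= om -> om ^+ 2 = a ^+ 2 + k ^+ 2 ->
  {within `[0, T], continuous S} ->
  (forall t, t \in `]0, T[ -> is_derive t 1 S (dS t)) ->
  (forall t, t \in `]0, T[ -> speed ip g v t <= dS t) ->
  e0 ^+ 2 + e1 ^+ 2 + e2 ^+ 2 + e3 ^+ 2 = 1 ->
  0 <= t1 -> t1 <= t2 -> t2 <= T ->
  acos (spin_dotX (a * S t2) (g t2) e0 e1 e2 e3) -
  acos (spin_dotX (a * S t1) (g t1) e0 e1 e2 e3) <= om * (S t2 - S t1).
Proof.
move=> gv om0 om2 cS DS dS_ge e_1 t10 t12 t2T; have [_ gvC gS gh] := gv.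
have [Cp Cq] := gvC 0 0; have [Cr Cs] := gvC 0 1.
apply: (@rotating_frame_angle_le R T _ _ _ _ _ _ _ _ Cp Cq Cr Cs _ _ _
  S dS a k om e0 e1 e2 e3 t1 t2 om0 om2 cS DS _ _ e_1 t10 t12 t2T _ erefl).
- by move=> t /gS /su2mx_coordsE[].
- by move=> t tT; have [] := horizontal_coords (gS _ tT) (gh _ tT).
- by move=> t tT; have [] := horizontal_coords (gS _ tT) (gh _ tT).
- by move=> t /dS_ge; apply: le_trans; exact: speed_ge0.
- move=> t tT; have tTc : t \in `[0, T] by apply: subset_itv_oo_cc tT.
  have := row_norm2_speed gv tTc; rewrite /row_norm2 => ->.
  have sp0 := speed_ge0 g v t; have sp := dS_ge _ tT.
  have k0 := ltW k_gt0.
  by rewrite ler_pXn2r// ?nnegrE ?mulr_ge0// ?(le_trans sp0)// ler_wpM2l.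
Qed.

Lemma curve_length_ge0 T g v : 0 <= curve_length ip T g v.
Proof. by apply: Rintegral_ge0 => t _; exact: speed_ge0. Qed.

(** In the frame turned by [a l], the endpoint is at spherical distance at most [om l] from the
    identity; [cos] reverses the inequality on [[0, pi]]. *)
Lemma cos_length_le T g v a om l : horizontal_curve T g v -> g 0 = 1%:M ->
  0 <= om -> om ^+ 2 = a ^+ 2 + k ^+ 2 ->
  curve_length ip T g v <= l -> om * l <= pi ->
  cos (om * l) <= unspin (cos (a * l)) (sin (a * l)) (Re (g T 0 0)) (Im (g T 0 0)).
Proof.
move=> gv g0 om0 om2 gl oml; have T0 := hc_time gv.
have [S [cS DS S0 ST]] := continuous_primitive T0 (within_continuous_speed gv).
rewrite -/(curve_length ip T g v) in ST.
pose L := curve_length ip T g v.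
have L0 : 0 <= L by exact: curve_length_ge0.
(* The slack [d] between [l] and the length is used up at the start: the parameter begins at [d]
   instead of 0, so that it ends at [l]. *)
pose d : R := l - L.
have d0 : 0 <= d by rewrite subr_ge0.
have oma : `|a| <= om.
  by rewrite -sqrtr_sqr -[om]ger0_norm// -sqrtr_sqr ler_sqrt ?sqr_ge0// om2 lerDl sqr_ge0.
have e_1 : 1 ^+ 2 + 0 ^+ 2 + 0 ^+ 2 + 0 ^+ 2 = 1 :> R by ring.
have := @horizontal_angle_le T g v (fun t => S t + d) (speed ip g v) a om 1 0 0 0
  0 T gv om0 om2 _ _ (fun _ _ => lexx _) e_1 (lexx _) T0 (lexx _).
rewrite ST S0 -/L add0r (_ : L + d = l); last by rewrite /d; ring.
rewrite g0 spin_dotX_id spin_dotX1 mulr1 mulr0 subr0 => ang.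
have {}ang : acos (unspin (cos (a * l)) (sin (a * l)) (Re (g T 0 0)) (Im (g T 0 0)))
    <= om * l.
  (* The initial offset turns the frame by [a d], at a cost of at most [om d] because
     [|a| <= om]. *)
  have ad : acos (cos (a * d)) <= om * d.
    rewrite -cos_norm normrM (ger0_norm d0) cosK.
      by rewrite ler_wpM2r.
    rewrite in_itv/= mulr_ge0//=; apply: le_trans oml.
    apply: ler_pM => //; rewrite /d; lra.
  have : om * l = om * d + om * L by rewrite /d; ring.
  have dL : l - d = L by rewrite /d; ring.
  rewrite dL in ang.
  suff : acos (unspin (cos (a * l)) (sin (a * l)) (Re (g T 0 0)) (Im (g T 0 0))) -
    acos (cos (a * d)) <= om * L by lra.
  apply: ang.
  - by apply: within_continuousD => // t; exact: cvg_cst.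
  - by move=> t tT; have DSt := DS _ tT; apply: is_derive_eq; rewrite addr0.
have TT : T \in `[0, T] by rewrite in_itv/= T0 lexx.
have b1 := spin_dotX_bound (a * l) (hc_SU2 gv TT) e_1.
rewrite spin_dotX1 in b1.
rewrite -[leRHS]acosK; last by rewrite in_itv/=.
rewrite leNgt ltr_cos ?in_itv/= ?acos_ge0 ?acos_lepi// -?leNgt//.
by rewrite oml andbT (le_trans _ ang)// acos_ge0.
Qed.

End AngleBounds.

(** * Extremals *)

Section Extremals.
Local Open Scope complex_scope.
Variable R : realType.
Local Notation mx := ('M[R[i]]_2).
Local Notation Re := (@complex.Re R).
Local Notation Im := (@complex.Im R).

(** This is quaternion multiplication. *)
Lemma su2mxM (p q r s p' q' r' s' : R) :
  su2mx p q r s *m su2mx p' q' r' s' =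
  su2mx (p * p' - q * q' - r * r' - s * s') (p * q' + q * p' - s * r' + r * s')
        (p * r' - q * s' + r * p' + s * q') (p * s' + q * r' + s * p' - r * q').
Proof.
by apply: mx2P; rewrite mulmx2E !mxE /=; apply/eqP; rewrite eq_complex /=;
  apply/andP; split; apply/eqP; ring.
Qed.

Lemma C1_realT (T : R) (f df : R -> R) :
  (forall t : R, is_derive t 1 f (df t)) -> continuous df -> C1_real T f df.
Proof.
move=> Df cdf; split=> //; apply: continuous_subspaceT => // t.
by have /derivable1_diffP/differentiable_continuous := @ex_derive _ _ _ _ _ _ _ (Df t).
Qed.

Lemma C1_realN (T : R) (f df : R -> R) : C1_real T f df ->
  C1_real T (fun t => - f t) (fun t => - df t).
Proof.
move=> [cf cdf Df]; split; [| |move=> t /Df; exact: is_deriveN];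
  by move=> t; apply: cvgN; first [exact: cf|exact: cdf].
Qed.

Variables (a om k1 k2 : R).

(* [extremal t] is [e^(A t) e^((- A + P) t)] with [A = diag (i a, - i a)] and
   [P] antidiagonal with upper entry [k1 + i k2], where
   [om ^ 2 = a ^ 2 + k1 ^ 2 + k2 ^ 2]. *)
Definition extremal (t : R) : mx :=
  let c := cos (a * t) in let s := sin (a * t) in
  let C := cos (om * t) in let S := sin (om * t) in
  su2mx (C * c + a / om * S * s) (C * s - a / om * S * c)
        (S / om * (k1 * c - k2 * s)) (S / om * (k1 * s + k2 * c)).

(** This is [e^(A t) P e^((- A + P) t)], where [om ^ 2 - a ^ 2] stands for [k1 ^ 2 + k2 ^ 2]. *)
Definition extremal_velocity (t : R) : mx :=
  let c := cos (a * t) in let s := sin (a * t) in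
  let C := cos (om * t) in let S := sin (om * t) in
  let m1 := k1 * c - k2 * s in let m2 := k1 * s + k2 * c in
  su2mx (- ((om ^+ 2 - a ^+ 2) / om * S * c)) (- ((om ^+ 2 - a ^+ 2) / om * S * s))
        (m1 * C - m2 * (a / om * S)) (m2 * C + m1 * (a / om * S)).

Lemma extremal0 : extremal 0 = 1%:M.
Proof.
rewrite /extremal !mulr0 cos0 sin0 su2mx1; apply: mx2P; rewrite !mxE /=;
by apply/eqP; rewrite eq_complex /=; apply/andP; split; apply/eqP; ring.
Qed.

Hypothesis om_neq0 : om != 0.

Lemma C1_extremal (T : R) : C1_curve T extremal extremal_velocity.
Proof.
have Dc (t : R) : is_derive t 1 (fun t => cos (a * t)) (- sin (a * t) * (a * 1)).
  by apply: (@is_derive1_comp _ _ (fun t => a * t)); exact: is_deriveMl.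
have Ds (t : R) : is_derive t 1 (fun t => sin (a * t)) (cos (a * t) * (a * 1)).
  by apply: (@is_derive1_comp _ _ (fun t => a * t)); exact: is_deriveMl.
have DC (t : R) : is_derive t 1 (fun t => cos (om * t)) (- sin (om * t) * (om * 1)).
  by apply: (@is_derive1_comp _ _ (fun t => om * t)); exact: is_deriveMl.
have DS (t : R) : is_derive t 1 (fun t => sin (om * t)) (cos (om * t) * (om * 1)).
  by apply: (@is_derive1_comp _ _ (fun t => om * t)); exact: is_deriveMl.
have smooth f : (forall t : R, derivable f t 1) -> continuous f.
  by move=> Df t; apply/differentiable_continuous/derivable1_diffP.
have Cp : C1_real T (fun t => Re (extremal t 0 0))
    (fun t => Re (extremal_velocity t 0 0)).
  have -> : (fun t => Re (extremal t 0 0)) =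
      (fun t => cos (om * t) * cos (a * t) + a / om * sin (om * t) * sin (a * t)).
    by apply/funext => t; rewrite mxE.
  have -> : (fun t => Re (extremal_velocity t 0 0)) =
      (fun t => - ((om ^+ 2 - a ^+ 2) / om * sin (om * t) * cos (a * t))).
    by apply/funext => t; rewrite mxE.
  apply: C1_realT => [t|]; last by apply: smooth => t; exact: ex_derive.
  by apply: is_derive_eq; rewrite -![_ *: _]/(_ * _); field.
have Cq : C1_real T (fun t => Im (extremal t 0 0))
    (fun t => Im (extremal_velocity t 0 0)).
  have -> : (fun t => Im (extremal t 0 0)) =
      (fun t => cos (om * t) * sin (a * t) - a / om * sin (om * t) * cos (a * t)).
    by apply/funext => t; rewrite mxE.
  have -> : (fun t => Im (extremal_velocity t 0 0)) =
      (fun t => - ((om ^+ 2 - a ^+ 2) / om * sin (om * t) * sin (a * t))).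
    by apply/funext => t; rewrite mxE.
  apply: C1_realT => [t|]; last by apply: smooth => t; exact: ex_derive.
  by apply: is_derive_eq; rewrite -![_ *: _]/(_ * _); field.
have Cr : C1_real T (fun t => Re (extremal t 0 1))
    (fun t => Re (extremal_velocity t 0 1)).
  have -> : (fun t => Re (extremal t 0 1)) =
      (fun t => sin (om * t) / om * (k1 * cos (a * t) - k2 * sin (a * t))).
    by apply/funext => t; rewrite mxE.
  have -> : (fun t => Re (extremal_velocity t 0 1)) =
      (fun t => (k1 * cos (a * t) - k2 * sin (a * t)) * cos (om * t) -
         (k1 * sin (a * t) + k2 * cos (a * t)) * (a / om * sin (om * t))).
    by apply/funext => t; rewrite mxE.
  apply: C1_realT => [t|]; last by apply: smooth => t; exact: ex_derive.
  by apply: is_derive_eq; rewrite -![_ *: _]/(_ * _); field.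
have Cs : C1_real T (fun t => Im (extremal t 0 1))
    (fun t => Im (extremal_velocity t 0 1)).
  have -> : (fun t => Im (extremal t 0 1)) =
      (fun t => sin (om * t) / om * (k1 * sin (a * t) + k2 * cos (a * t))).
    by apply/funext => t; rewrite mxE.
  have -> : (fun t => Im (extremal_velocity t 0 1)) =
      (fun t => (k1 * sin (a * t) + k2 * cos (a * t)) * cos (om * t) +
         (k1 * cos (a * t) - k2 * sin (a * t)) * (a / om * sin (om * t))).
    by apply/funext => t; rewrite mxE.
  apply: C1_realT => [t|]; last by apply: smooth => t; exact: ex_derive.
  by apply: is_derive_eq; rewrite -![_ *: _]/(_ * _); field.
have E (f g : R -> R) : f =1 g -> f = g by move=> ?; exact/funext.
(* Up to sign, the coordinates of the second row are those of the first. *)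
move=> i j; case: (ord2P i) => ->; case: (ord2P j) => ->; split=> //.
- have -> : (fun t => Re (extremal t 1 0)) = (fun t => - Re (extremal t 0 1)).
    by apply: E => t; rewrite !mxE.
  have -> : (fun t => Re (extremal_velocity t 1 0)) =
      (fun t => - Re (extremal_velocity t 0 1)).
    by apply: E => t; rewrite !mxE.
  exact: C1_realN.
- have -> : (fun t => Im (extremal t 1 0)) = (fun t => Im (extremal t 0 1)).
    by apply: E => t; rewrite !mxE.
  have -> : (fun t => Im (extremal_velocity t 1 0)) =
      (fun t => Im (extremal_velocity t 0 1)).
    by apply: E => t; rewrite !mxE.
  exact: Cs.
- have -> : (fun t => Re (extremal t 1 1)) = (fun t => Re (extremal t 0 0)).
    by apply: E => t; rewrite !mxE.
  have -> : (fun t => Re (extremal_velocity t 1 1)) =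
      (fun t => Re (extremal_velocity t 0 0)).
    by apply: E => t; rewrite !mxE.
  exact: Cp.
- have -> : (fun t => Im (extremal t 1 1)) = (fun t => - Im (extremal t 0 0)).
    by apply: E => t; rewrite !mxE.
  have -> : (fun t => Im (extremal_velocity t 1 1)) =
      (fun t => - Im (extremal_velocity t 0 0)).
    by apply: E => t; rewrite !mxE.
  exact: C1_realN.
Qed.

Variable k : R.
Hypothesis k2E : k1 ^+ 2 + k2 ^+ 2 = k ^+ 2.
Hypothesis om2E : om ^+ 2 = a ^+ 2 + k ^+ 2.

Lemma extremal_m2 t : (k1 * cos (a * t) - k2 * sin (a * t)) ^+ 2 +
  (k1 * sin (a * t) + k2 * cos (a * t)) ^+ 2 = k ^+ 2.
Proof. by rewrite -[RHS]mulr1 -k2E -(cos2Dsin2 (a * t)); ring. Qed.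

Lemma extremal_unit t :
  let X := extremal t in
  Re (X 0 0) ^+ 2 + Im (X 0 0) ^+ 2 + Re (X 0 1) ^+ 2 + Im (X 0 1) ^+ 2 = 1.
Proof.
rewrite /= !mxE /=; set m1 := _ - k2 * _; set m2 := _ + k2 * _.
have m12 : m1 ^+ 2 + m2 ^+ 2 = k ^+ 2 by exact: extremal_m2.
set c := cos (a * t); set s := sin (a * t).
set C := cos (om * t); set S := sin (om * t).
have cs : c ^+ 2 + s ^+ 2 = 1 by exact: cos2Dsin2.
have CS : C ^+ 2 + S ^+ 2 = 1 by exact: cos2Dsin2.
transitivity ((C ^+ 2 + (a / om) ^+ 2 * S ^+ 2) * (c ^+ 2 + s ^+ 2) +
  S ^+ 2 / om ^+ 2 * (m1 ^+ 2 + m2 ^+ 2)); first by field.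
rewrite cs m12 mulr1 -CS.
have -> : k ^+ 2 = om ^+ 2 - a ^+ 2 by rewrite om2E; ring.
by field.
Qed.

Lemma SU2_extremal t : SU2 (extremal t).
Proof. by apply: SU2_su2mx; have := extremal_unit t; rewrite /= !mxE. Qed.

Lemma extremal_horizontal t :
  su2_antidiag (extremal_velocity t *m invmx (extremal t)).
Proof.
have [/unitarymx_unit Xu _] := SU2_extremal t.
rewrite /extremal_velocity.
set m1 := _ - k2 * _; set m2 := _ + k2 * _.
have m12 : m1 ^+ 2 + m2 ^+ 2 = k ^+ 2 by exact: extremal_m2.
set c := cos (a * t); set s := sin (a * t).
set C := cos (om * t); set S := sin (om * t).
have cs : c ^+ 2 + s ^+ 2 = 1 by exact: cos2Dsin2.
(* The right velocity is [e^(A t) P e^(- A t)], with upper entry [(k1 + i k2) e^(2 i a t)]. *)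
apply/su2_antidiagP; exists (m1 * c - m2 * s), (m1 * s + m2 * c).
apply: (canLR (mulmxK Xu)); rewrite su2mxM -/m1 -/m2 -/c -/s -/C -/S.
have -> : om ^+ 2 - a ^+ 2 = m1 ^+ 2 + m2 ^+ 2 by rewrite om2E m12; ring.
congr su2mx.
- by field.
- by field.
- rewrite -[m1 * C]mulr1 -[m2 * (_ * _)]mulr1 -cs; ring.
- rewrite -[m2 * C]mulr1 -[m1 * (_ * _)]mulr1 -cs; ring.
Qed.

Lemma extremal_row_norm2 t : row_norm2 (extremal_velocity t) = k ^+ 2.
Proof.
rewrite /row_norm2 /extremal_velocity; set m1 := _ - k2 * _; set m2 := _ + k2 * _.
have m12 : m1 ^+ 2 + m2 ^+ 2 = k ^+ 2 by exact: extremal_m2.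
rewrite !mxE /=.
set c := cos (a * t); set s := sin (a * t).
set C := cos (om * t); set S := sin (om * t).
have cs : c ^+ 2 + s ^+ 2 = 1 by exact: cos2Dsin2.
have CS : C ^+ 2 + S ^+ 2 = 1 by exact: cos2Dsin2.
have kE : om ^+ 2 - a ^+ 2 = k ^+ 2 by rewrite om2E; ring.
transitivity ((om ^+ 2 - a ^+ 2) ^+ 2 / om ^+ 2 * S ^+ 2 * (c ^+ 2 + s ^+ 2) +
  (m1 ^+ 2 + m2 ^+ 2) * (C ^+ 2 + (a / om) ^+ 2 * S ^+ 2)); first by field.
rewrite cs m12 mulr1 -kE -[RHS]mulr1 -CS; by field.
Qed.

Lemma horizontal_extremal T : 0 <= T ->
  horizontal_curve T extremal extremal_velocity.
Proof.
move=> T0; split=> //; first exact: C1_extremal.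
- by move=> t _; exact: SU2_extremal.
- by move=> t _; exact: extremal_horizontal.
Qed.

(** In the rotating frame the extremal becomes [e^((- A + P) t)], the great circle leaving the
    identity in the direction [(0, - a, k1, k2) / om]. *)
Lemma spin_extremal t (c := cos (a * t)) (s := sin (a * t)) (X := extremal t) :
  [/\ unspin c s (Re (X 0 0)) (Im (X 0 0)) = cos (om * t),
      unspin c s (Im (X 0 0)) (- Re (X 0 0)) = - (a / om * sin (om * t)),
      unspin c s (Re (X 0 1)) (Im (X 0 1)) = k1 / om * sin (om * t) &
      unspin c s (Im (X 0 1)) (- Re (X 0 1)) = k2 / om * sin (om * t)].
Proof.
have cs : c ^+ 2 + s ^+ 2 = 1 by exact: cos2Dsin2.
rewrite /X !mxE /= -/c -/s /unspin.
by split; rewrite -[RHS]mulr1 -cs; field.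
Qed.

End Extremals.

(** * Optimality of extremals up to time [pi / om] *)

Section Optimality.
Local Open Scope complex_scope.
Variable R : realType.
Local Notation mx := ('M[R[i]]_2).
Local Notation Re := (@complex.Re R).
Local Notation Im := (@complex.Im R).
Implicit Types (t T : R) (g v : R -> mx).
Variables (ip : mx -> mx -> R) (k : R).
Hypothesis k_gt0 : 0 < k.
Hypothesis speedE : forall T g v, horizontal_curve T g v ->
  forall t, t \in `[0, T] -> speed ip g v t = k^-1 * Num.sqrt (row_norm2 (v t)).

Lemma unit_speed_length T g v : 0 <= T ->
  (forall t, t \in `[0, T] -> speed ip g v t = 1) -> curve_length ip T g v = T.
Proof.
move=> T0 g1; rewrite /curve_length.
under eq_Rintegral do [rewrite g1; last by rewrite -inE].
rewrite Rintegral_cst//= lebesgue_measure_itv/= lte_fin mul1r.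
by move: T0; rewrite le_eqVlt => /predU1P[<-|->] /=; rewrite ?ltxx ?oppr0 ?addr0.
Qed.

Lemma SU2_unspin_inj th (X Y : mx) : SU2 X -> SU2 Y ->
  let c := cos th in let s := sin th in
  unspin c s (Re (X 0 0)) (Im (X 0 0)) = unspin c s (Re (Y 0 0)) (Im (Y 0 0)) ->
  unspin c s (Im (X 0 0)) (- Re (X 0 0)) = unspin c s (Im (Y 0 0)) (- Re (Y 0 0)) ->
  unspin c s (Re (X 0 1)) (Im (X 0 1)) = unspin c s (Re (Y 0 1)) (Im (Y 0 1)) ->
  unspin c s (Im (X 0 1)) (- Re (X 0 1)) = unspin c s (Im (Y 0 1)) (- Re (Y 0 1)) ->
  X = Y.
Proof.
move=> /su2mx_coordsE[-> _] /su2mx_coordsE[-> _]; rewrite !mxE /=.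
have unspin_inj (p q p' q' : R) :
  unspin (cos th) (sin th) p q = unspin (cos th) (sin th) p' q' ->
  unspin (cos th) (sin th) q (- p) = unspin (cos th) (sin th) q' (- p') ->
  p = p' /\ q = q'.
  have cs := cos2Dsin2 th; rewrite /unspin => e1 e2; split.
    have : p * (cos th ^+ 2 + sin th ^+ 2) = p' * (cos th ^+ 2 + sin th ^+ 2).
      transitivity (cos th * (p * cos th + q * sin th) -
        sin th * (q * cos th + - p * sin th)).
        by ring.
      by rewrite e1 e2; ring.
    by rewrite cs !mulr1.
  have : q * (cos th ^+ 2 + sin th ^+ 2) = q' * (cos th ^+ 2 + sin th ^+ 2).
    transitivity (sin th * (p * cos th + q * sin th) +
      cos th * (q * cos th + - p * sin th)).
      by ring.
    by rewrite e1 e2; ring.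
  by rewrite cs !mulr1.
by move=> e1 e2 e3 e4; have [-> ->] := unspin_inj _ _ _ _ e1 e2;
   have [-> ->] := unspin_inj _ _ _ _ e3 e4.
Qed.

Variables a om k1 k2 : R.
Hypothesis om_gt0 : 0 < om.
Hypothesis k2E : k1 ^+ 2 + k2 ^+ 2 = k ^+ 2.
Hypothesis om2E : om ^+ 2 = a ^+ 2 + k ^+ 2.
Let om_neq0 : om != 0. Proof. by rewrite gt_eqF. Qed.
Local Notation ext := (extremal a om k1 k2).
Local Notation dext := (extremal_velocity a om k1 k2).

Lemma speed_extremal t : 0 <= t -> speed ip ext dext t = 1.
Proof.
move=> t0; rewrite (speedE (horizontal_extremal om_neq0 k2E om2E t0)).
  by rewrite (extremal_row_norm2 om_neq0 k2E om2E) sqrtr_sqr gtr0_norm// mulVf// gt_eqF.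
by rewrite in_itv/= t0 lexx.
Qed.

Lemma extremal_length_le T T' g v : 0 < T -> om * T <= pi ->
  horizontal_curve T' g v -> g 0 = 1%:M -> g T' = ext T ->
  T <= curve_length ip T' g v.
Proof.
move=> T0 omT gv g0 gT; rewrite leNgt; apply/negP => lT.
have l0 := curve_length_ge0 ip T' g v.
(* A value strictly below [T] but positive, even for a competitor of length 0, since [l] will be a
   divisor. *)
have [l [l_gt0 ll lT']] : exists l : R,
    [/\ 0 < l, curve_length ip T' g v <= l & l < T].
  by exists ((curve_length ip T' g v + T) / 2); split; lra.
have l_neq0 : l != 0 by rewrite gt_eqF.
(* With [a' l = a T] the frame ends in the same position as for the extremal, whereas
   [om' l < om T]; this contradicts the monotonicity of [cos] on [[0, pi]]. *)
pose a' := a * T / l; pose om' : R := Num.sqrt (a' ^+ 2 + k ^+ 2).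
have om'0 : 0 <= om' by exact: sqrtr_ge0.
have om'2 : om' ^+ 2 = a' ^+ 2 + k ^+ 2 by rewrite sqr_sqrtr ?addr_ge0 ?sqr_ge0.
have k20 : 0 < k ^+ 2 by rewrite exprn_gt0.
have lt_om : om' * l < om * T.
  rewrite -(@ltr_pXn2r _ 2)// ?nnegrE ?mulr_ge0 ?(ltW om_gt0) ?(ltW T0) ?(ltW l_gt0)//.
  rewrite !exprMn om'2 om2E.
  have a'l : a' ^+ 2 * l ^+ 2 = a ^+ 2 * T ^+ 2 by rewrite /a'; field.
  have : k ^+ 2 * l ^+ 2 < k ^+ 2 * T ^+ 2.
    by rewrite ltr_pM2l// ltr_pXn2r// ?nnegrE; exact: ltW.
  by move: a'l; lra.
have omega_pi : om' * l <= pi by apply: le_trans omT; exact: ltW.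
have := fun ll => cos_length_le k_gt0 speedE gv g0 om'0 om'2 ll omega_pi.
have -> : a' * l = a * T by rewrite /a'; field.
rewrite gT; have [-> _ _ _] := spin_extremal a k1 k2 om_neq0 T.
move=> /(_ ll); rewrite leNgt ltr_cos ?lt_om// in_itv/=.
  by rewrite mulr_ge0// ltW.
by rewrite omT andbT mulr_ge0// ltW.
Qed.

Lemma sr_dist_extremal T : 0 < T -> om * T <= pi ->
  sr_dist ip 1%:M (ext T) = T%:E.
Proof.
move=> T0 omT; apply/eqP; rewrite eq_le; apply/andP; split.
  apply: ereal_inf_lbound; exists T, ext, dext; split=> //.
  - exact: (horizontal_extremal om_neq0 k2E om2E (ltW T0)).
  - exact: extremal0.
  - rewrite unit_speed_length//; first exact: ltW.
    by move=> t; rewrite in_itv/= => /andP[t0 _]; exact: speed_extremal.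
apply: le_ereal_inf_tmp => _ [T' [g [v [gv g0 gT ->]]]].
by rewrite lee_fin; exact: extremal_length_le gT.
Qed.

Lemma arclength_geodesic_extremal T : 0 < T -> om * T <= pi ->
  arclength_geodesic ip T ext dext.
Proof.
move=> T0 omT; have sp t : t \in `[0, T] -> speed ip ext dext t = 1.
  by rewrite in_itv/= => /andP[t0 _]; exact: speed_extremal.
split=> //; split; first exact: (horizontal_extremal om_neq0 k2E om2E (ltW T0)).
by rewrite extremal0 sr_dist_extremal// unit_speed_length// ltW.
Qed.

(** * Rigidity of minimizers sharing the endpoint of an extremal *)

Section Rigidity.
Variables (T : R) (g v : R -> mx).
Hypothesis omT : om * T <= pi.
Hypothesis gv : horizontal_curve T g v.
Hypothesis g1 : forall t, t \in `[0, T] -> speed ip g v t = 1.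
Hypothesis g0 : g 0 = 1%:M.
Hypothesis gT : g T = ext T.

Let angle_le e0 e1 e2 e3 t1 t2 :
  e0 ^+ 2 + e1 ^+ 2 + e2 ^+ 2 + e3 ^+ 2 = 1 ->
  0 <= t1 -> t1 <= t2 -> t2 <= T ->
  acos (spin_dotX (a * t2) (g t2) e0 e1 e2 e3) -
  acos (spin_dotX (a * t1) (g t1) e0 e1 e2 e3) <= om * (t2 - t1).
Proof.
apply: (@horizontal_angle_le R ip k k_gt0 speedE T g v id (fun=> 1) a om
  e0 e1 e2 e3 t1 t2 gv (ltW om_gt0) om2E) => [|t tT].
- by apply: continuous_subspaceT => t; exact: cvg_id.
- by rewrite g1//; apply: subset_itv_oo_cc tT.
Qed.

(** The angle from the identity grows by at most [om t] before time [t] and by at most [om (T - t)]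
    after it, but by [om T] in total; both bounds are therefore equalities. *)
Lemma geodesic_to_extremal_cos t : t \in `[0, T] ->
  unspin (cos (a * t)) (sin (a * t)) (Re (g t 0 0)) (Im (g t 0 0)) = cos (om * t).
Proof.
move=> tT; have := tT; rewrite in_itv/= => /andP[t0 tT'].
have T0 : 0 <= T by exact: le_trans tT'.
have e_1 : 1 ^+ 2 + 0 ^+ 2 + 0 ^+ 2 + 0 ^+ 2 = 1 :> R by ring.
have xt := spin_dotX_bound (a * t) (hc_SU2 gv tT) e_1.
have h1 := angle_le e_1 (lexx 0) t0 tT'.
have h2 := angle_le e_1 t0 tT' (lexx T).
rewrite !spin_dotX1 gT g0 in h1 h2 xt.
have [ET _ _ _] := spin_extremal a k1 k2 om_neq0 T; rewrite ET in h2.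
rewrite cosK in h2; last by rewrite in_itv/= omT mulr_ge0// ltW.
rewrite !mxE /= mulr0 cos0 sin0 /unspin mul1r mul0r addr0 acos1 in h1.
rewrite -/(unspin _ _ _ _) in h1.
rewrite -[LHS]acosK ?in_itv//; congr cos.
by apply/eqP; rewrite eq_le; apply/andP; split; lra.
Qed.

(** In the rotating frame, the angles to the identity and to the antipode of the endpoint are both
    known at time [t]. They fix the components of the point in the plane of the great circle, and
    these already have norm 1. *)
Lemma geodesic_to_extremal t : om * T < pi -> t \in `[0, T] -> g t = ext t.
Proof.
move=> omT' tT; have := tT; rewrite in_itv/= => /andP[t0 tT'].
have T0 : 0 <= T by exact: le_trans tT'.
have [eT|T_neq0] := eqVneq T 0.
  have -> : t = 0 by apply/eqP; rewrite eq_le t0 -eT tT'.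
  by rewrite g0 extremal0.
have T_gt0 : 0 < T by rewrite lt0r T_neq0.
have omT0 : 0 < om * T by rewrite mulr_gt0.
pose S := sin (om * T).
have S0 : 0 < S by rewrite sin_gt0_pi// omT0.
have [ET0 ET1 ET2 ET3] := spin_extremal a k1 k2 om_neq0 T.
have [et0 et1 et2 et3] := spin_extremal a k1 k2 om_neq0 t.
pose n1 : R := - (a / om); pose n2 := k1 / om; pose n3 := k2 / om.
have nE : n1 ^+ 2 + n2 ^+ 2 + n3 ^+ 2 = 1.
  transitivity ((a ^+ 2 + (k1 ^+ 2 + k2 ^+ 2)) / om ^+ 2).
    by rewrite /n1 /n2 /n3; field.
  by rewrite k2E -om2E mulfV// expf_neq0.
(* These are the coordinates of the antipode of the endpoint. The antipode is used because the
   estimate bounds increases of the angle, which here goes from [pi - om T] to [pi]. *)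
have e_1 : (- cos (om * T)) ^+ 2 + (- (n1 * S)) ^+ 2 + (- (n2 * S)) ^+ 2
    + (- (n3 * S)) ^+ 2 = 1.
  transitivity (cos (om * T) ^+ 2 + S ^+ 2 * (n1 ^+ 2 + n2 ^+ 2 + n3 ^+ 2)).
    by ring.
  by rewrite nE mulr1 cos2Dsin2.
have yt := spin_dotX_bound (a * t) (hc_SU2 gv tT) e_1.
have h1 := angle_le e_1 (lexx 0) t0 tT'.
have h2 := angle_le e_1 t0 tT' (lexx T).
have yT : spin_dotX (a * T) (g T) (- cos (om * T)) (- (n1 * S)) (- (n2 * S))
    (- (n3 * S)) = -1.
  rewrite -e_1 /spin_dotX /spin_dot gT ET0 ET1 ET2 ET3 -/S /n1 /n2 /n3; ring.
rewrite yT acosN1 in h2.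
rewrite g0 spin_dotX_id mulr0 cos0 sin0 mul1r mul0r subr0 in h1.
rewrite acosN ?cos_geN1 ?cos_le1// cosK in h1; last by rewrite in_itv/= omT ltW.
have cos_t := geodesic_to_extremal_cos tT.
set y := spin_dotX (a * t) _ _ _ _ _ in yt h1 h2.
have yE : - y = cos (om * (T - t)).
  rewrite -[y]acosK ?in_itv//.
  have -> : acos y = pi - om * (T - t).
    by apply/eqP; rewrite eq_le; apply/andP; split; lra.
  by rewrite addrC cosDpi cosN opprK.
rewrite mulrBr cosB -/S in yE.
set u0 := unspin _ _ _ _ in cos_t.
pose u1 := unspin (cos (a * t)) (sin (a * t)) (Im (g t 0 0)) (- Re (g t 0 0)).
pose u2 := unspin (cos (a * t)) (sin (a * t)) (Re (g t 0 1)) (Im (g t 0 1)).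
pose u3 := unspin (cos (a * t)) (sin (a * t)) (Im (g t 0 1)) (- Re (g t 0 1)).
have gS := hc_SU2 gv tT; have [_ gt1] := su2mx_coordsE gS.
have uE : u0 ^+ 2 + u1 ^+ 2 + u2 ^+ 2 + u3 ^+ 2 = 1.
  rewrite -gt1 -[RHS]mulr1 -(cos2Dsin2 (a * t)) /u0 /u1 /u2 /u3 /unspin; ring.
have yE' : y = - (u0 * cos (om * T)) - S * (n1 * u1 + n2 * u2 + n3 * u3).
  by rewrite /y /spin_dotX /spin_dot -/u0 -/u1 -/u2 -/u3; ring.
(* Dividing by [sin (om T)] is where [om T < pi] matters: at a diagonal endpoint the direction of
   the great circle is undetermined. *)
have nu : n1 * u1 + n2 * u2 + n3 * u3 = sin (om * t).
  apply: (mulfI (lt0r_neq0 S0)); rewrite yE' cos_t in yE; lra.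
have dist0 : (u1 - n1 * sin (om * t)) ^+ 2 + (u2 - n2 * sin (om * t)) ^+ 2 +
    (u3 - n3 * sin (om * t)) ^+ 2 = 0.
  transitivity ((u0 ^+ 2 + u1 ^+ 2 + u2 ^+ 2 + u3 ^+ 2) - u0 ^+ 2
    - 2 * sin (om * t) * (n1 * u1 + n2 * u2 + n3 * u3)
    + sin (om * t) ^+ 2 * (n1 ^+ 2 + n2 ^+ 2 + n3 ^+ 2)); first by ring.
  by rewrite uE nu nE cos_t; have := cos2Dsin2 (om * t); lra.
have /and3P[/eqP z1 /eqP z2 /eqP z3] : [&& u1 - n1 * sin (om * t) == 0,
    u2 - n2 * sin (om * t) == 0 & u3 - n3 * sin (om * t) == 0].
  move/eqP: dist0; rewrite paddr_eq0 ?addr_ge0 ?sqr_ge0// => /andP[].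
  by rewrite paddr_eq0 ?sqr_ge0// !sqrf_eq0 => /andP[-> ->] ->.
have extS := SU2_extremal om_neq0 k2E om2E t.
apply: (@SU2_unspin_inj (a * t)) => //.
- by rewrite et0.
- by rewrite et1 -/u1; rewrite /n1 in z1; lra.
- by rewrite et2 -/u2; rewrite /n2 in z2; lra.
- by rewrite et3 -/u3; rewrite /n3 in z3; lra.
Qed.

End Rigidity.
End Optimality.

(** * Endpoints of extremals *)

Section Reachability.
Local Open Scope complex_scope.
Variable R : realType.
Local Notation mx := ('M[R[i]]_2).
Local Notation Re := (@complex.Re R).
Local Notation Im := (@complex.Im R).

(** Polar coordinates of [p + i |q|], a point of the closed upper half plane. *)
Lemma polar_upper (p q : R) : exists al : R, [/\ 0 <= al <= pi,
  p = Num.sqrt (p ^+ 2 + q ^+ 2) * cos al &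
  `|q| = Num.sqrt (p ^+ 2 + q ^+ 2) * sin al].
Proof.
pose C : R := Num.sqrt (p ^+ 2 + q ^+ 2); rewrite -/C.
have C0 : 0 <= C by exact: sqrtr_ge0.
have C2 : C ^+ 2 = p ^+ 2 + q ^+ 2 by rewrite sqr_sqrtr// addr_ge0 ?sqr_ge0.
have [CE|C_neq0] := eqVneq C 0.
  have /andP[/eqP -> /eqP ->] : (p == 0) && (q == 0).
    move/eqP: C2; rewrite CE expr0n eq_sym paddr_eq0 ?sqr_ge0//.
    by rewrite !sqrf_eq0.
  by exists 0; rewrite CE !mul0r normr0 lexx pi_ge0.
have Cgt0 : 0 < C by rewrite lt0r C_neq0.
have pC : p ^+ 2 <= C ^+ 2 by rewrite C2 lerDl sqr_ge0.
have pC1 : -1 <= p / C <= 1.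
  rewrite ler_pdivlMr// ler_pdivrMr// mulN1r mul1r -ler_norml.
  by rewrite -(@ler_pXn2r _ 2)// ?nnegrE// real_normK// num_real.
exists (acos (p / C)); split.
- by rewrite acos_ge0// acos_lepi.
- by rewrite acosK ?in_itv// mulrC divfK.
- have /andP[pC_ge pC_le] := pC1.
  rewrite sin_acos//; apply/eqP; rewrite -(@eqrXn2 _ 2)// ?mulr_ge0 ?sqrtr_ge0//.
  rewrite real_normK ?num_real// exprMn [X in _ * X]sqr_sqrtr; last by nra.
  by rewrite mulrBr mulr1 -exprMn mulrC divfK// C2 addrC addKr.
Qed.

(** The sign [e] reduces the search for an extremal to [z = C e^(- i al)] with [al] in [[0, pi]]:
    taking [e = -1] reverses [a] and conjugates [z]. *)
Lemma opposite_sign (q : R) : exists e : R, [/\ e ^+ 2 = 1,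
  forall x, cos (e * x) = cos x, forall x, sin (e * x) = e * sin x
  & q = - (e * `|q|)].
Proof.
have [q0|q0] := leP 0 q.
  exists (-1); rewrite sqrrN expr1n (ger0_norm q0) mulN1r opprK.
  by split=> // x; rewrite mulN1r ?cosN// sinN mulN1r.
exists 1; rewrite expr1n (ltr0_norm q0) mul1r opprK.
by split=> // x; rewrite !mul1r.
Qed.

(* If [cos tau = C cos be] and [s = C sin be / sin tau], then
   [cos tau - i s sin tau = C e^(- i be)], so the extremal with [a / om = s]
   ends at [z = C e^(i (s tau - be))] when [om T = tau].  The phase
   [be - s tau] is continuous in [be] and fixes 0 and [pi]. *)
Lemma angle_onto (C al : R) : 0 <= C < 1 -> 0 <= al <= pi ->
  exists be tau : R, [/\ 0 < tau < pi, cos tau = C * cos be &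
    al + C * sin be / sin tau * tau = be].
Proof.
move=> /andP[C0 C1] al_pi.
have Ccos be : -1 < C * cos be < 1.
  have := cos_geN1 be; have := cos_le1 be; move=> ? ?; apply/andP; split; nra.
have Ccos_le be : -1 <= C * cos be <= 1.
  by have /andP[? ?] := Ccos be; rewrite !ltW.
pose rad be : R := 1 - (C * cos be) ^+ 2.
have rad0 be : 0 < rad be by have /andP[? ?] := Ccos be; rewrite /rad; nra.
(* [h] is the phase [be - s tau], with [tau = acos (C cos be)] and [sin tau] written as a square
   root; [C < 1] keeps this root positive. *)
pose h be : R := be - C * sin be / Num.sqrt (rad be) * acos (C * cos be).
have cC : continuous (fun be : R => C * cos be).
  by move=> be; apply: cvgM; [exact: cvg_cst|exact: continuous_cos].
have hc : continuous h.
  move=> be; apply: cvgB; first exact: cvg_id.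
  apply: cvgM; last first.
    apply: (@continuous_comp _ _ _ (fun be : R => C * cos be) (@acos R)).
      exact: cC.
    exact: continuous_acos.
  apply: cvgM; first by apply: cvgM; [exact: cvg_cst|exact: continuous_sin].
  apply: cvgV; first by rewrite gt_eqF// sqrtr_gt0.
  apply: (@continuous_comp _ _ _ rad (@Num.sqrt R)); last exact: sqrt_continuous.
  apply: cvgB; first exact: cvg_cst.
  by apply: cvgM; exact: cC.
have h0 : h 0 = 0 by rewrite /h sin0 mulr0 !mul0r subrr.
have hpi : h pi = pi by rewrite /h sinpi mulr0 !mul0r subr0.
have [|||be be_pi hbe] := @IVT R h 0 pi al.
- exact: pi_ge0.
- exact: continuous_subspaceT.
- by rewrite h0 hpi (min_idPl (pi_ge0 R)) (max_idPr (pi_ge0 R)).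
exists be, (acos (C * cos be)); split.
- have /andP[? ?] := Ccos be.
  by rewrite acos_gt0 ?acos_ltpi//; apply/andP; split=> //; exact: ltW.
- by rewrite acosK// in_itv/=.
- by rewrite sin_acos// -hbe /h subrK.
Qed.

(** [tau] is the angle travelled on the great circle in the rotating frame. *)
Definition reachable (k tau : R) (X : mx) := exists a om k1 k2 T : R,
  [/\ 0 < om, k1 ^+ 2 + k2 ^+ 2 = k ^+ 2, om ^+ 2 = a ^+ 2 + k ^+ 2,
      0 < T /\ om * T = tau & X = extremal a om k1 k2 T].

(** Here [sg = a / om] and [(m1, m2) = (k1, k2) / om], and the equations are those of
    [spin_extremal]; [om] is then forced by [om^2 (1 - sg^2) = k^2]. *)
Lemma reachable_of_angles (k sg tau m1 m2 : R) (X : mx) : 0 < k -> SU2 X ->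
  0 < tau -> sg ^+ 2 < 1 -> m1 ^+ 2 + m2 ^+ 2 = 1 - sg ^+ 2 ->
  let c := cos (sg * tau) in let s := sin (sg * tau) in
  unspin c s (Re (X 0 0)) (Im (X 0 0)) = cos tau ->
  unspin c s (Im (X 0 0)) (- Re (X 0 0)) = - (sg * sin tau) ->
  unspin c s (Re (X 0 1)) (Im (X 0 1)) = m1 * sin tau ->
  unspin c s (Im (X 0 1)) (- Re (X 0 1)) = m2 * sin tau ->
  reachable k tau X.
Proof.
move=> k0 XS tau0 sg1 m12 /= X0 X1 X2 X3.
have rad0 : 0 < 1 - sg ^+ 2 by rewrite subr_gt0.
pose om : R := k / Num.sqrt (1 - sg ^+ 2).
have om0 : 0 < om by rewrite divr_gt0// sqrtr_gt0.
have om_neq0 : om != 0 by rewrite gt_eqF.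
have om2 : om ^+ 2 * (1 - sg ^+ 2) = k ^+ 2.
  by rewrite exprMn exprVn sqr_sqrtr ?ltW// mulfVK// gt_eqF.
have k2E : (om * m1) ^+ 2 + (om * m2) ^+ 2 = k ^+ 2.
  by rewrite -om2 -m12; ring.
have om2E : om ^+ 2 = (sg * om) ^+ 2 + k ^+ 2 by rewrite -om2; ring.
exists (sg * om), om, (om * m1), (om * m2), (tau / om); split=> //.
  by rewrite divr_gt0// mulrC divfK.
have aT : sg * om * (tau / om) = sg * tau by field.
have omT : om * (tau / om) = tau by field.
have [E0 E1 E2 E3] := spin_extremal (sg * om) (om * m1) (om * m2) om_neq0 (tau / om).
rewrite aT omT in E0 E1 E2 E3.
have r1 : sg * om / om = sg by field.
have r2 : om * m1 / om = m1 by field.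
have r3 : om * m2 / om = m2 by field.
rewrite r1 in E1; rewrite r2 in E2; rewrite r3 in E3.
apply: (@SU2_unspin_inj _ (sg * tau)) => //.
- exact: (SU2_extremal om_neq0 k2E om2E).
- by rewrite E0.
- by rewrite E1.
- by rewrite E2.
- by rewrite E3.
Qed.

Lemma reachable_nondiag (k : R) (X : mx) : 0 < k -> SU2 X -> X 0 1 != 0 ->
  exists2 tau, tau < pi & reachable k tau X.
Proof.
move=> k0 XS X01; have [_ X1] := su2mx_coordsE XS.
set p := Re (X 0 0) in X1; set q := Im (X 0 0) in X1.
set r := Re (X 0 1) in X1; set s := Im (X 0 1) in X1.
have rs0 : 0 < r ^+ 2 + s ^+ 2.
  rewrite lt0r addr_ge0 ?sqr_ge0// andbT paddr_eq0 ?sqr_ge0// !sqrf_eq0.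
  by apply: contra X01 => rs; rewrite eq_complex.
have [al [al_pi pE qE]] := polar_upper p q.
pose C : R := Num.sqrt (p ^+ 2 + q ^+ 2); rewrite -/C in pE qE.
have C2 : C ^+ 2 = p ^+ 2 + q ^+ 2 by rewrite sqr_sqrtr// addr_ge0 ?sqr_ge0.
have C01 : 0 <= C < 1.
  rewrite sqrtr_ge0/= -(@ltr_pXn2r _ 2)// ?nnegrE ?sqrtr_ge0// C2 expr1n; lra.
have [be [tau [tau_pi ctau albe]]] := angle_onto C01 al_pi.
have /andP[tau0 taupi] := tau_pi.
have st0 : 0 < sin tau by exact: sin_gt0_pi.
have st_neq0 : sin tau != 0 by rewrite gt_eqF.
have st2 : sin tau ^+ 2 = 1 - C ^+ 2 * cos be ^+ 2.
  by rewrite sin2cos2 ctau exprMn.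
have [e [e2 ce se qE']] := opposite_sign q.
pose sg0 : R := C * sin be / sin tau.
pose sg := e * sg0.
have csg : cos (sg * tau) = cos (sg0 * tau) by rewrite /sg -mulrA ce.
have ssg : sin (sg * tau) = e * sin (sg0 * tau) by rewrite /sg -mulrA se.
have sgst : sg0 * sin tau = C * sin be by rewrite /sg0 divfK.
have sg2 : sg ^+ 2 * sin tau ^+ 2 = C ^+ 2 * sin be ^+ 2.
  by rewrite exprMn e2 mul1r -exprMn sgst exprMn.
have rad : (1 - sg ^+ 2) * sin tau ^+ 2 = r ^+ 2 + s ^+ 2.
  rewrite mulrBl mul1r sg2 st2; have := cos2Dsin2 be => csb.
  transitivity (1 - C ^+ 2 * (cos be ^+ 2 + sin be ^+ 2)); first by ring.
  by rewrite csb mulr1 C2; lra.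
exists tau => //.
pose c := cos (sg * tau); pose sn := sin (sg * tau).
have csn : c ^+ 2 + sn ^+ 2 = 1 by exact: cos2Dsin2.
have cbe : cos be = cos al * cos (sg0 * tau) - sin al * sin (sg0 * tau).
  by rewrite -{1}albe cosD.
have sbe : sin be = sin al * cos (sg0 * tau) + cos al * sin (sg0 * tau).
  by rewrite -{1}albe sinD.
(* The angles [tau] and [sg tau] are fixed by [z]. Then [m1] and [m2] are read off from [w], and
   their norm is right because [|z|^2 + |w|^2 = 1]. *)
apply: (@reachable_of_angles k sg tau (unspin c sn r s / sin tau)
  (unspin c sn s (- r) / sin tau)) => //.
- by rewrite -subr_gt0 -(pmulr_lgt0 _ (exprn_gt0 2 st0)) rad.
- apply: (mulIf (expf_neq0 2 st_neq0)); rewrite rad.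
  rewrite -[RHS]mulr1 -csn /unspin; by field.
- rewrite csg ssg -/p -/q ctau cbe qE' qE /unspin.
  transitivity (C * cos al * cos (sg0 * tau) - e ^+ 2 * (C * sin al) * sin (sg0 * tau)).
    by rewrite -pE; ring.
  by rewrite e2; ring.
- rewrite csg ssg -/p -/q.
  have -> : - (sg * sin tau) = - (e * (sg0 * sin tau)) by rewrite /sg; ring.
  by rewrite sgst sbe qE' qE {1}pE /unspin; ring.
- by rewrite divfK.
- by rewrite divfK.
Qed.

Lemma reachable_diag (k : R) (X : mx) : 0 < k -> SU2 X -> X 0 1 = 0 ->
  X != 1%:M -> reachable k pi X.
Proof.
move=> k0 XS X01 X_neq1; have [XE X1] := su2mx_coordsE XS.
rewrite X01 /= expr0n !addr0 in X1.
set p := Re (X 0 0) in X1; set q := Im (X 0 0) in X1.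
have [al [/andP[al0 al_pi] pE qE]] := polar_upper (- p) q.
rewrite sqrrN X1 sqrtr1 !mul1r in pE qE.
(* Excluding the identity gives [al < pi], hence [|sg| < 1]. *)
have al_ltpi : al < pi.
  rewrite lt_neqAle al_pi andbT; apply: contra_neq X_neq1 => alE.
  have p1 : p = 1 by rewrite -[p]opprK pE alE cospi opprK.
  have q0 : q = 0 by apply/eqP; rewrite -normr_eq0 qE alE sinpi.
  by rewrite XE X01 /= -/p -/q p1 q0 su2mx1.
have [e [e2 ce se qE']] := opposite_sign q.
have pi0 := pi_gt0 R.
pose sg : R := e * (al / pi).
have csg : cos (sg * pi) = - p by rewrite pE /sg -mulrA divfK ?gt_eqF.
have ssg : sin (sg * pi) = - q.
  by rewrite qE' qE opprK /sg -mulrA divfK ?gt_eqF.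
have sg1 : sg ^+ 2 < 1.
  rewrite exprMn e2 mul1r expr_lt1// ?divr_ge0// ?ltW//.
  by rewrite ltr_pdivrMr// mul1r.
(* At [tau = pi] the entry [w] vanishes for every direction of [P], so any [(m1, m2)] of the right
   norm will do. *)
apply: (@reachable_of_angles k sg pi (Num.sqrt (1 - sg ^+ 2)) 0) => //.
- by rewrite expr0n addr0 sqr_sqrtr// subr_ge0 ltW.
- by rewrite csg ssg -/p -/q cospi /unspin -X1; ring.
- by rewrite csg ssg -/p -/q sinpi /unspin; ring.
- by rewrite X01 /= sinpi /unspin; ring.
- by rewrite X01 /= sinpi /unspin; ring.
Qed.

End Reachability.

(** * The cut locus *)

Section CutLocus.
Local Open Scope complex_scope.
Variable R : realType.
Local Notation mx := ('M[R[i]]_2).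
Local Notation Re := (@complex.Re R).
Local Notation Im := (@complex.Im R).

Lemma SU2_diagP (X : mx) : SU2_diag X <->
  exists2 pq : R * R, X = su2mx pq.1 pq.2 0 0 & pq.1 ^+ 2 + pq.2 ^+ 2 = 1.
Proof.
split=> [Xd|[[p q] -> pq1]]; last first.
  have S : SU2 (su2mx p q 0 0) by apply: SU2_su2mx; rewrite /= in pq1; rewrite pq1; ring.
  by apply/(SU2_diagE S); rewrite mxE.
have [XS _] := Xd; have [XE X1] := su2mx_coordsE XS.
have X01 := (SU2_diagE XS).1 Xd; rewrite X01 /= expr0n !addr0 in XE X1.
by exists (Re (X 0 0), Im (X 0 0)).
Qed.

Lemma SU2_diag_comm (k X : mx) : SU2_diag k -> SU2_diag X -> k *m X = X *m k.
Proof.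
move=> /SU2_diagP[[p q] -> _] /SU2_diagP[[p' q'] -> _]; rewrite !su2mxM.
by congr su2mx; rewrite /=; ring.
Qed.

Lemma isotropyE (k X : mx) : SU2_diag k -> isotropy X k <-> k *m X = X *m k.
Proof.
move=> kd; have [[/unitarymx_unit ku _] _] := kd.
split=> [[_ kX]|kX]; first by rewrite -{2}kX mulmxKV.
by split=> //; rewrite kX mulmxK.
Qed.

(** A diagonal matrix commuting with a nondiagonal point is scalar, so it fixes every point; a
    diagonal point is fixed by all of [K]. *)
Lemma SU2_singE : @SU2_sing R = @SU2_diag R.
Proof.
apply/seteqP; split=> X.
  move=> [XS nmin]; apply: contra_notP nmin => Xnd.
  have X01 : X 0 1 != 0 by apply/eqP => /(SU2_diagE XS).
  split=> [|Y YS k]; first by exists X.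
  move=> [kd kX]; apply/isotropyE => //.
  have {}kX := (isotropyE X kd).1 (conj kd kX).
  have /SU2_diagP[[p q] kE _] := kd.
  suff q0 : q = 0.
    have -> : k = (p%:C)%:M.
      rewrite kE q0; apply: mx2P; rewrite !mxE /= ?mulr1n ?mulr0n ?oppr0 //.
    by rewrite scalar_mxC.
  move/(congr1 (fun A : mx => A 0 1)): kX; rewrite !mulmx2E kE !mxE /= mul0r addr0.
  rewrite mulr0 add0r mulrC => /(mulfI X01) /eqP; rewrite eq_complex /= => /andP[_ /eqP].
  lra.
move=> Xd; split=> [|[_ Xmin]]; first by case: Xd.
(* [diag (i, - i)] fixes the diagonal point [X] but not the antidiagonal point [Y], so the isotropy
   group of [X] is not minimal. *)
pose k : mx := su2mx 0 1 0 0.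
have kd : SU2_diag k by apply/SU2_diagP; exists (0, 1) => //=; ring.
pose Y : mx := su2mx 0 0 1 0.
have YS : SU2 Y by apply: SU2_su2mx; ring.
have /(isotropyE Y kd) : isotropy Y k.
  by apply: Xmin YS _ _; apply/isotropyE => //; exact: SU2_diag_comm.
rewrite !su2mxM => /(congr1 (fun A : mx => A 0 1)); rewrite !mxE /= => /eqP.
by rewrite eq_complex /= => /andP[_ /eqP]; lra.
Qed.

Variables (ip : mx -> mx -> R) (k : R).
Hypothesis k_gt0 : 0 < k.
Hypothesis speedE : forall T g v, horizontal_curve T g v ->
  forall t, t \in `[0, T] -> speed ip g v t = k^-1 * Num.sqrt (row_norm2 (v t)).

Lemma sr_dist_refl : (sr_dist ip 1%:M 1%:M <= 0)%E.
Proof.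
apply: ereal_inf_lbound; exists 0, (fun=> 1%:M), (fun=> 0); split=> //.
  split=> // [i j|t _|t _].
  - have C1c (x : R) : C1_real 0 (fun=> x) (fun=> 0).
      by apply: C1_realT; exact: cst_continuous.
    by split; rewrite [(0 : mx) i j]mxE; exact: C1c.
  - by rewrite su2mx1; apply: SU2_su2mx; ring.
  - by apply/su2_antidiagP; exists 0, 0; rewrite /right_velocity mul0mx su2mx0.
by rewrite /curve_length set_itv1 Rintegral_set1.
Qed.

Lemma reachable_neq1 (X : mx) : SU2 X -> X != 1%:M ->
  exists2 tau, tau <= pi & reachable k tau X.
Proof.
move=> XS X1; have [X01|X01] := eqVneq (X 0 1) 0.
  by exists pi => //; exact: reachable_diag.
by have [tau tau_pi Xr] := reachable_nondiag k_gt0 XS X01; exists tau => //; exact: ltW.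
Qed.

Lemma arclength_geodesicE T g v : arclength_geodesic ip T g v -> g 0 = 1%:M ->
  sr_dist ip 1%:M (g T) = T%:E.
Proof.
move=> [[gv gd] g1] g0; rewrite -g0 -gd unit_speed_length//.
exact: hc_time gv.
Qed.

(* By rigidity [Re (e^(- i a t) z) = cos (om t)] along the minimizer.  At a
   diagonal point [z' = 0], so differentiating gives [om ^ 2 = a ^ 2]. *)
Lemma geodesic_interior_nondiag T g v t : arclength_geodesic ip T g v ->
  g 0 = 1%:M -> 0 < t < T -> g t 0 1 != 0.
Proof.
move=> ag g0 /andP[t0 tT]; have [[gv _] g1] := ag.
have T_gt0 : 0 < T by exact: lt_trans tT.
have TT : T \in `[0, T] by rewrite in_itv/= lexx ltW.
have dT := arclength_geodesicE ag g0.
have gT1 : g T != 1%:M.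
  apply/eqP => gT; have := sr_dist_refl.
  by rewrite -{2}gT dT lee_fin leNgt T_gt0.
have [tau tau_pi [a [om [k1 [k2 [T0 [om0 k2E om2E [T00 omT0] gTE]]]]]]] :=
  reachable_neq1 (hc_SU2 gv TT) gT1.
rewrite -omT0 in tau_pi.
have om_neq0 : om != 0 by rewrite gt_eqF.
have T0E : T0 = T.
  apply: EFin_inj; rewrite -dT gTE.
  by rewrite (sr_dist_extremal k_gt0 speedE om0 k2E om2E T00 tau_pi).
rewrite T0E in tau_pi gTE.
have cosE := geodesic_to_extremal_cos k_gt0 speedE om0 om2E tau_pi gv g1 g0 gTE.
have tTo : t \in `]0, T[ by rewrite in_itv/= t0.
have tTc : t \in `[0, T] by apply: subset_itv_oo_cc tTo.
apply/eqP => gt01.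
have gS := hc_SU2 gv tTc; have [_ gt1] := su2mx_coordsE gS.
have [ud uh _] := horizontal_coords gS (hc_horizontal gv tTc).
have [[_ _ Dp] [_ _ Dq]] := hc_C1 gv 0 0.
have {}Dp := Dp _ tTo; have {}Dq := Dq _ tTo.
have Da : is_derive t 1 (fun t => a * t) (a * 1) by exact: is_deriveMl.
have Dx := is_derive_unspin Dp Dq Da.
have Dcos : is_derive t 1 (fun t => cos (om * t)) (- sin (om * t) * (om * 1)).
  by apply: (@is_derive1_comp _ _ (fun t => om * t)); exact: is_deriveMl.
rewrite gt01 /= expr0n !mul0r !addr0 subr0 in gt1 ud uh.
set p := Re (g t 0 0) in gt1 ud uh Dx; set q := Im (g t 0 0) in gt1 ud uh Dx.
set dp := Re (v t 0 0) in ud uh Dx; set dq := Im (v t 0 0) in ud uh Dx.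
have dp0 : dp = 0.
  transitivity (p * (p * dp + q * dq) + q * (q * dp - p * dq)).
    by rewrite -[LHS]mul1r -gt1; ring.
  by rewrite ud uh !mulr0 addr0.
have dq0 : dq = 0.
  transitivity (q * (p * dp + q * dq) - p * (q * dp - p * dq)).
    by rewrite -[LHS]mul1r -gt1; ring.
  by rewrite ud uh !mulr0 subr0.
have {}Dx : - sin (om * t) * om = a * unspin (cos (a * t)) (sin (a * t)) q (- p).
  (* Since [t] is interior, the identity [cosE] holds in a neighbourhood of [t] and can be
     differentiated. *)
  have Dx' : is_derive t 1 (fun t => cos (om * t)) (unspin (cos (a * t)) (sin (a * t))
      (dp + a * 1 * q) (dq - a * 1 * p)).
    apply: near_eq_is_derive Dx.
    near=> u; rewrite cosE//; apply: subset_itv_oo_cc; near: u.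
    exact: near_in_itvoo.
  have := @derive_val _ _ _ _ _ _ _ Dx'; rewrite (@derive_val _ _ _ _ _ _ _ Dcos).
  rewrite dp0 dq0 !mulr1 => ->; rewrite /unspin; ring.
have x2y2 : unspin (cos (a * t)) (sin (a * t)) p q ^+ 2 +
    unspin (cos (a * t)) (sin (a * t)) q (- p) ^+ 2 = 1.
  by rewrite -gt1 -[RHS]mulr1 -(cos2Dsin2 (a * t)) /unspin; ring.
rewrite /p /q cosE// -/p -/q in x2y2.
have y2 : unspin (cos (a * t)) (sin (a * t)) q (- p) ^+ 2 = sin (om * t) ^+ 2.
  by rewrite sin2cos2 -x2y2; ring.
have st0 : 0 < sin (om * t).
  rewrite sin_gt0_pi// mulr_gt0//=; apply: lt_le_trans tau_pi.
  by rewrite ltr_pM2l.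
have : sin (om * t) ^+ 2 * om ^+ 2 = sin (om * t) ^+ 2 * a ^+ 2.
  transitivity ((- sin (om * t) * om) ^+ 2); first by ring.
  by rewrite Dx exprMn y2 mulrC.
move/(mulfI (expf_neq0 2 (lt0r_neq0 st0))); rewrite om2E.
have : 0 < k ^+ 2 by rewrite exprn_gt0.
lra.
Unshelve. all: by end_near. Qed.

(** The endpoint is diagonal because [sin pi = 0]; a minimizing continuation would have this
    diagonal point in its interior. *)
Lemma extremal_loses_optimality a om k1 k2 T :
  0 < om -> k1 ^+ 2 + k2 ^+ 2 = k ^+ 2 -> om ^+ 2 = a ^+ 2 + k ^+ 2 ->
  om * T = pi ->
  geodesic_loses_optimality ip 1%:M (extremal a om k1 k2 T).
Proof.
move=> om0 k2E om2E omT.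
have T0 : 0 < T by rewrite -(pmulr_rgt0 _ om0) omT pi_gt0.
exists T, (extremal a om k1 k2), (extremal_velocity a om k1 k2); split=> //.
- by apply: (arclength_geodesic_extremal k_gt0) => //; rewrite omT.
- exact: extremal0.
move=> [T' [g' [v' [TT' ag' g'E]]]].
have g'0 : g' 0 = 1%:M by rewrite g'E ?extremal0// in_itv/= lexx ltW.
have tT' : 0 < T < T' by rewrite T0.
have := geodesic_interior_nondiag ag' g'0 tT'.
rewrite g'E; last by rewrite in_itv/= lexx ltW.
by rewrite mxE /= omT sinpi !mul0r eqxx.
Qed.

Lemma sr_cut_locusE : sr_cut_locus ip 1%:M = @SU2_diag R.
Proof.
apply/seteqP; split=> X; last first.
  move=> Xd; have [XS _] := Xd.
  have X01 := (SU2_diagE XS).1 Xd.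
  have [->|X1] := eqVneq X 1%:M; last first.
    left; have [a [om [k1 [k2 [T [om0 k2E om2E [_ omT] ->]]]]]] :=
      reachable_diag k_gt0 XS X01 X1.
    exact: extremal_loses_optimality.
  right; split=> // e e0.
  (* With [a = pi / e] the extremal loses optimality at time [pi / om < e], so such points
     accumulate at the identity. *)
  pose a : R := pi / e; pose om : R := Num.sqrt (a ^+ 2 + k ^+ 2).
  have a0 : 0 < a by rewrite divr_gt0// pi_gt0.
  have k20 : 0 < k ^+ 2 by rewrite exprn_gt0.
  have om2E : om ^+ 2 = a ^+ 2 + k ^+ 2.
    by rewrite sqr_sqrtr ?addr_ge0 ?sqr_ge0.
  have om0 : 0 < om by rewrite sqrtr_gt0 addr_gt0// exprn_gt0.
  have k2E : k ^+ 2 + 0 ^+ 2 = k ^+ 2 by rewrite expr0n addr0.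
  have omT : om * (pi / om) = pi by rewrite mulrC divfK// gt_eqF.
  have T0 : 0 < pi / om by rewrite divr_gt0// pi_gt0.
  exists (extremal a om k 0 (pi / om)); first exact: extremal_loses_optimality.
  rewrite (sr_dist_extremal k_gt0 speedE om0 k2E om2E T0) ?omT// lte_fin.
  rewrite ltr_pdivrMr// -ltr_pdivrMl// mulrC -/a.
  rewrite -(@ltr_pXn2r _ 2)// ?nnegrE ?ltW// om2E; lra.
move=> [[T [g [v [T0 ag g0 gT noext]]]]|[-> _]]; last first.
  by apply/SU2_diagP; exists (1, 0); [exact: su2mx1|rewrite /= expr1n expr0n addr0].
have [[gv _] g1] := ag.
have TT : T \in `[0, T] by rewrite in_itv/= lexx ltW.
have XS : SU2 X by rewrite -gT; exact: (hc_SU2 gv TT).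
apply/(SU2_diagE XS)/eqP; apply: contra_notT noext => X01.
have [tau tau_pi [a [om [k1 [k2 [T1 [om0 k2E om2E [T10 omT1] XE]]]]]]] :=
  reachable_nondiag k_gt0 XS X01.
have T1E : T1 = T.
  apply: EFin_inj; rewrite -(arclength_geodesicE ag g0) gT XE.
  by rewrite (sr_dist_extremal k_gt0 speedE om0 k2E om2E T10)// omT1 ltW.
rewrite -omT1 T1E in tau_pi; rewrite T1E -gT in XE.
have omT : om * (pi / om) = pi by rewrite mulrC divfK// gt_eqF.
(* By rigidity the geodesic is an extremal with [om T < pi], which still minimizes up to time
   [pi / om]. *)
exists (pi / om), (extremal a om k1 k2), (extremal_velocity a om k1 k2); split.
- by rewrite ltr_pdivlMr// mulrC.
- by apply: (arclength_geodesic_extremal k_gt0) => //; rewrite ?omT// divr_gt0// pi_gt0.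
- move=> t tT; symmetry.
  exact: (geodesic_to_extremal k_gt0 speedE om0 k2E om2E (ltW tau_pi) gv g1 g0 XE).
Qed.

End CutLocus.

Theorem mainTheorem5 (R : realType) (ip : 'M[R[i]]_2 -> 'M[R[i]]_2 -> R)
    (hip : biinvariant_inner_product ip) :
  @SU2_diag R = @SU2_sing R /\
  @SU2_diag R = sr_cut_locus ip 1%:M.
Proof.
have [k k_gt0 speedE] := speed_row_norm hip.
by rewrite SU2_singE (sr_cut_locusE k_gt0 speedE).
Qed.
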